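(* Let $\alpha\ge 1$ and $k$ be positive integers with $k>\frac{17\alpha+15}{8}$, and let $n=k\alpha$. Then for every $G\in\mathcal{G}_{n,\alpha}$ we have $\lambda(G)\ge\lambda(P_{n,\alpha})$, with equality if and only if $G$ is isomorphic to $P_{n,\alpha}$.
   Context: All graphs are finite and simple. For a graph $G$, $\lambda(G)$ denotes the spectral radius of its adjacency matrix. For integers $n\ge\alpha\ge1$, $\mathcal{G}_{n,\alpha}$ is the set of all connected graphs of order $n$ with independence number $\alpha$. For $n=k\alpha$ with $k\ge 2$, the clique path $P_{n,\alpha}$ is the graph whose vertex set is a disjoint union $V_1\cup\cdots\cup V_\alpha$ with $|V_i|=k$, where each $V_i$ induces a complete graph $K_k$; for each $i=1,\dots,\alpha-1$ there is exactly one edge between $V_i$ and $V_{i+1}$, say $a_ib_{i+1}$ with $a_i\in V_i$, $b_{i+1}\in V_{i+1}$, where $b_i\neq a_i$ for $2\le i\le\alpha-1$; there are no other edges between different $V_i$'s. (It is obtained from a path on $\alpha$ vertices by blowing up each vertex to a $K_k$, with $2\alpha-2$ cut vertices.) *)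

(* Defs.v *)
From HB Require Import structures.
From mathcomp Require Import all_boot all_order all_algebra all_field.
Set Implicit Arguments. Unset Strict Implicit. Unset Printing Implicit Defensive.
Import Order.TTheory GRing.Theory Num.Theory.

Definition simple_graph (n : nat) (e : rel 'I_n) : Prop :=
  symmetric e /\ irreflexive e.

Definition connected_graph (n : nat) (e : rel 'I_n) : Prop :=
  forall x y : 'I_n, connect e x y.

Definition independent (n : nat) (e : rel 'I_n) (S : {set 'I_n}) : bool :=
  [forall x in S, forall y in S, ~~ e x y].

Definition indep_num (n : nat) (e : rel 'I_n) : nat :=
  \max_(S : {set 'I_n} | independent e S) #|S|.

(* Clique path P_{k*alpha, alpha}: vertex v lies in block v %/ k at position v %% k.
   Each block is a clique K_k; between consecutive blocks i, i+1 the single edge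
   joins a_i = (block i, position 1) with b_{i+1} = (block i+1, position 0),
   so b_i <> a_i as required (k >= 2). *)
Definition cp_link (k : nat) (u v : nat) : bool :=
  [&& v %/ k == (u %/ k).+1, u %% k == 1%N & v %% k == 0%N].

Definition clique_path (k alpha : nat) : rel 'I_(k * alpha) :=
  fun u v =>
    [|| (u %/ k == v %/ k) && (u != v), cp_link k u v | cp_link k v u].
Arguments clique_path k alpha : clear implicits.

Local Open Scope ring_scope.

Definition adjmx (n : nat) (e : rel 'I_n) : 'M[algC]_n :=
  \matrix_(i, j) (e i j)%:R.

Definition spec_roots (n : nat) (A : 'M[algC]_n) : seq algC :=
  sval (closed_field_poly_normal (char_poly A)).

Definition spectral_radius (n : nat) (A : 'M[algC]_n) : algC :=
  \big[Num.max/0]_(z <- spec_roots A) `|z|.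

Definition lambda (n : nat) (e : rel 'I_n) : algC := spectral_radius (adjmx e).

Definition graph_iso (n : nat) (e1 e2 : rel 'I_n) : Prop :=
  exists f : 'I_n -> 'I_n, bijective f /\ forall x y, e2 (f x) (f y) = e1 x y.

(* Main.v *)
Require Import Defs.
From HB Require Import structures.
From mathcomp Require Import all_boot all_order all_algebra all_field.
From mathcomp Require Import spectral zify ring lra.
Set Implicit Arguments. Unset Strict Implicit. Unset Printing Implicit Defensive.
Import Order.TTheory GRing.Theory Num.Theory.

(** Write [n = k * alpha].  The spectral radius of the clique path satisfies
    [lambda <= k - 1 + 2 / (k - 1)], so a competitor [G] with no larger spectral
    radius has, by its average degree, at most [alpha] edges more than the Turan
    bound.  The greedy proof of Turan's theorem is stable in this range: it covers
    [G] by [alpha] near-cliques with so few crossing edges that a missing edge or an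
    unbalanced block would give a stable set of size [alpha + 1] or a clique of size
    [k + 1].  Hence [G] consists of [alpha] disjoint copies of K_k joined by crossing
    edges.

    Put [t = lambda + 1] and [K = (t^2 - 1) (t - k)] for the clique path, and let [s]
    be the block sums of its Perron vector, symmetrised.  The eigenvalue equation
    becomes [K s_r = sum over the neighbours q of r in the path of (s_r + t s_q)];
    since [K <= 2 t + 2], [s] is concave, hence unimodal.  Reading it from the centre
    outwards, alternately on both sides, gives a decreasing sequence [z], in which
    position [i] is attached to position [i - 2].  The blocks of [G] can be numbered
    so that each block [i > 0] has an edge to some block [<= i - 2] (remove non-cut
    blocks one by one, never taking the chosen neighbour of the previous one).
    Giving block [i] the weight [z_i] then makes every edge contribute at least as
    much as in the path, and a suitable test vector on [G] has Rayleigh quotient at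
    least [lambda].  In the equality case the crossing edges form a matching, there
    is exactly one below each block [i > 0], and it leads to block [i - 2]. *)

(** * Clique partitions from a small number of edges *)

Section CliquePartition.
Variables (T : finType) (e : rel T).
Hypotheses (e_sym : symmetric e) (e_irr : irreflexive e).

Definition stable_set (I : {set T}) := {in I &, forall u v, ~~ e u v}.

Lemma sum_pairs_setID (U S : {set T}) (F : T -> T -> nat) : S \subset U ->
  \sum_(u in U) \sum_(v in U) F u v =
  \sum_(u in S) \sum_(v in S) F u v + \sum_(u in S) \sum_(v in U :\: S) F u v +
  (\sum_(u in U :\: S) \sum_(v in S) F u v +
   \sum_(u in U :\: S) \sum_(v in U :\: S) F u v).
Proof.
move=> SU; have split G : \sum_(u in U) G u = \sum_(u in S) G u + \sum_(u in U :\: S) G u.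
  by rewrite (big_setID S) /= (setIidPr SU).
rewrite split; congr (_ + _).
  by rewrite -big_split; apply: eq_bigr => u _; rewrite split.
by rewrite -big_split; apply: eq_bigr => u _; rewrite split.
Qed.

(* The greedy algorithm behind Turan's theorem: the blocks are the closed
   neighbourhoods of successive vertices of minimum degree. *)
Lemma greedy_partition (U : {set T}) :
  exists (b : T -> nat) (I : {set T}),
  [/\ I \subset U, stable_set I, {in U, forall u, b u < #|I|} &
    \sum_(u in U) \sum_(v in U) (e u v && (b u != b v)) +
    2 * (\sum_(u in U) \sum_(v in U) ((u != v) && (b u == b v)))
    <= 2 * (\sum_(u in U) \sum_(v in U) e u v)].
Proof.
move: {2}#|U|.+1 (ltnSn #|U|) => m; elim: m U => // m IH U Um.
have [->|[x xU]] := set_0Vmem U.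
  exists (fun=> 0), set0; split=> [|u v|u|]; rewrite ?inE ?sub0set //.
  by rewrite !big_set0.
pose deg u := \sum_(v in U) e u v.
have [v vU vmin] : exists2 v, v \in U & forall u, u \in U -> deg v <= deg u.
  by case: (arg_minnP deg xU) => v vU vmin; exists v.
pose S := [set u in U | (u == v) || e v u].
have SU : S \subset U by apply/subsetP=> u; rewrite inE => /andP[].
have vS : v \in S by rewrite inE vU eqxx.
have WlU : #|U :\: S| < m.
  rewrite -ltnS; apply: leq_trans Um; rewrite ltnS proper_card //.
  apply/properP; split; first exact: subsetDl.
  by exists v => //; rewrite inE vS.
have [b [I [IW Ist bI bE]]] := IH _ WlU.
(* The closed neighbourhood [S] of [v] becomes a block with label [#|I|], which is fresh since the
   recursive labels are smaller. *)
pose b' u := if u \in S then #|I| else b u.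
have vI : v \notin I by apply: contraL vS => /(subsetP IW); rewrite inE => /andP[].
have Ivst u : u \in I -> ~~ e v u.
  move=> uI; have := subsetP IW u uI; rewrite !inE => /andP[]; case: (u \in U) => //=.
  by rewrite negb_or => /andP[].
exists b', (v |: I); split.
- rewrite subUset sub1set vU (subset_trans IW) //; exact: subsetDl.
- move=> y z; rewrite !in_setU1 => /predU1P[->|yI] /predU1P[->|zI].
  + by rewrite e_irr.
  + exact: Ivst.
  + by rewrite e_sym Ivst.
  + exact: Ist.
- move=> u uU; rewrite cardsU1 vI add1n ltnS /b'; case: ifP => // uS.
  by apply/ltnW/bI; rewrite inE uS.
have SI u : u \in S -> b' u = #|I| by rewrite /b' => ->.
have Wb u : u \in U :\: S -> b' u = b u by rewrite inE /b' => /andP[/negPf-> _].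
have WI u : u \in U :\: S -> b' u != #|I|.
  by move=> uW; rewrite Wb // neq_ltn bI.
rewrite !(sum_pairs_setID _ SU).
set X := \sum_(u in S) \sum_(w in U :\: S) e u w.
have XE : \sum_(u in U :\: S) \sum_(w in S) e u w = X.
  by rewrite exchange_big; apply: eq_bigr => u _; apply: eq_bigr => w _; rewrite e_sym.
have -> : \sum_(u in S) \sum_(w in S) (e u w && (b' u != b' w)) = 0.
  by rewrite big1 // => u uS; rewrite big1 // => w wS; rewrite !SI // eqxx andbF.
have -> : \sum_(u in S) \sum_(w in U :\: S) (e u w && (b' u != b' w)) = X.
  apply: eq_bigr => u uS; apply: eq_bigr => w wW.
  by rewrite (SI u) // eq_sym WI ?andbT.
have -> : \sum_(u in U :\: S) \sum_(w in S) (e u w && (b' u != b' w)) = X.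
  rewrite -XE; apply: eq_bigr => u uW; apply: eq_bigr => w wS.
  by rewrite (SI w) // WI ?andbT.
have -> : \sum_(u in S) \sum_(w in S) ((u != w) && (b' u == b' w)) = #|S| * #|S|.-1.
  rewrite -sum_nat_const; apply: eq_bigr => u uS.
  rewrite (cardsD1 u S) uS add1n -sum1_card big_mkcond [RHS]big_mkcond /=.
  apply: eq_bigr => w _; rewrite in_setD1 eq_sym.
  by case: ifP => wS; rewrite ?andbF // !SI // eqxx !andbT; case: (w != u).
have -> : \sum_(u in S) \sum_(w in U :\: S) ((u != w) && (b' u == b' w)) = 0.
  rewrite big1 // => u uS; rewrite big1 // => w wW.
  by rewrite (SI u) // eq_sym [_ == b' w]eq_sym (negPf (WI _ wW)) andbF.
have -> : \sum_(u in U :\: S) \sum_(w in S) ((u != w) && (b' u == b' w)) = 0.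
  rewrite big1 // => u uW; rewrite big1 // => w wS.
  by rewrite (SI w) // (negPf (WI _ uW)) andbF.
have -> : \sum_(u in U :\: S) \sum_(w in U :\: S) (e u w && (b' u != b' w)) =
          \sum_(u in U :\: S) \sum_(w in U :\: S) (e u w && (b u != b w)).
  by apply: eq_bigr => u uW; apply: eq_bigr => w wW; rewrite !Wb.
have -> : \sum_(u in U :\: S) \sum_(w in U :\: S) ((u != w) && (b' u == b' w)) =
          \sum_(u in U :\: S) \sum_(w in U :\: S) ((u != w) && (b u == b w)).
  by apply: eq_bigr => u uW; apply: eq_bigr => w wW; rewrite !Wb.
rewrite XE.
(* Each vertex of [S] has degree at least [deg v >= #|S| - 1], by minimality of [v]. *)
have : #|S| * #|S|.-1 <= \sum_(u in S) \sum_(w in S) e u w + X.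
  rewrite -big_split /= -sum_nat_const; apply: leq_sum => u uS.
  have uU := subsetP SU u uS.
  have -> : \sum_(w in S) e u w + \sum_(w in U :\: S) e u w = deg u.
    by rewrite /deg [RHS](big_setID S) /= (setIidPr SU).
  apply: leq_trans (vmin u uU); rewrite (cardsD1 v S) vS add1n /=.
  rewrite /deg -sum1_card big_mkcond [X in _ <= X]big_mkcond; apply: leq_sum => w _.
  rewrite in_setD1 inE; case: (w \in U) => //=; last by rewrite andbF.
  by case: eqVneq => //= _; case: (e v w).
move: bE; lia.
Qed.

Section SpreadBlocks.
Variables (k a : nat) (b : T -> nat).
Hypothesis b_lt : forall u, b u < a.

Definition block i := [set u | b u == i].

Let crossing := \sum_u \sum_v (e u v && (b u != b v)).

Lemma sum_block_card : \sum_(i < a) #|block i| = #|T|.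
Proof.
rewrite -[RHS]sum1_card (partition_big (fun u => Ordinal (b_lt u)) predT) //=.
by apply: eq_bigr => i _; rewrite -sum1_card; apply: eq_bigl => u; rewrite inE -val_eqE.
Qed.

Lemma sum_same_block :
  \sum_u \sum_v ((u != v) && (b u == b v)) = \sum_(i < a) #|block i| * #|block i|.-1.
Proof.
rewrite (partition_big (fun u => Ordinal (b_lt u)) predT) //=.
apply: eq_bigr => i _; rewrite -sum_nat_const.
rewrite [RHS](eq_bigl (fun u => Ordinal (b_lt u) == i)); last first.
  by move=> u; rewrite inE -val_eqE.
apply: eq_bigr => u /eqP iE; have ub : u \in block i by rewrite inE -iE.
rewrite (cardsD1 u) ub add1n -sum1_card [RHS]big_mkcond; apply: eq_bigr => v _.
by rewrite in_setD1 inE -iE /= eq_sym [b v == _]eq_sym; case: (_ && _).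
Qed.

(** [crossing] counts ordered pairs, so an edge leaving block [j] is seen from both ends; hence the
    factor 2. *)
Lemma crossing_block_le j :
  2 * #|[set u in block j | [exists v, e u v && (b v != j)]]| <= crossing.
Proof.
pose cross u := \sum_v (e u v && (b u != b v)).
have -> : crossing = \sum_(u | b u == j) cross u + \sum_(u | b u != j) cross u.
  by rewrite /crossing (bigID (fun u => b u == j)).
have le1 : #|[set u in block j | [exists v, e u v && (b v != j)]]| <=
    \sum_(u | b u == j) cross u.
  rewrite -sum1_card big_mkcond [X in _ <= X]big_mkcond; apply: leq_sum => u _.
  rewrite !inE; case: eqP => //= uj; case: existsP => // -[v /andP[uv vj]].
  by rewrite /cross (bigD1 v) //= uv uj eq_sym vj.
have le2 : \sum_(u | b u == j) cross u <= \sum_(u | b u != j) cross u.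
  have -> : \sum_(u | b u == j) cross u =
      \sum_(u | b u == j) \sum_(v | b v != j) (e u v && (b u != b v)).
    apply: eq_bigr => u /eqP uj; rewrite /cross (bigID (fun v => b v == j)) /=.
    by rewrite big1 // => v /eqP->; rewrite uj eqxx andbF.
  rewrite exchange_big; apply: leq_sum => v _.
  rewrite /cross [X in _ <= X](bigID (fun u => b u == j)) /=.
  apply: leq_trans (leq_addr _ _); apply: leq_sum => u _.
  by rewrite e_sym eq_sym.
by rewrite mul2n -addnn leq_add // (leq_trans le1 le2).
Qed.

Hypothesis spread : forall j, j < a -> crossing < 2 * #|block j|.
Hypothesis stable_le : forall I, stable_set I -> #|I| <= a.

(* Two non-adjacent vertices of one block, together with a vertex without
   crossing edges in each other block, would be stable. *)
Lemma spread_block_clique u v : b u = b v -> u != v -> e u v.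
Proof.
move=> buv uv; apply: contraT => nuv.
have free (j : 'I_a) : exists w, (b w == j) && [forall x, e w x ==> (b x == j)].
  have /properP[_ [w wj]] : [set u in block j | [exists v, e u v && (b v != j)]]
      \proper block j.
    rewrite properEcard; apply/andP; split.
      by apply/subsetP=> w; rewrite inE => /andP[].
    have := crossing_block_le j; have := spread (ltn_ord j); lia.
  rewrite inE wj /= negb_exists => /forallP wfree; exists w.
  rewrite inE in wj; rewrite wj; apply/forallP=> x; apply/implyP=> wx.
  by have := wfree x; rewrite wx negbK.
pose w j := xchoose (free j).
have wb j : b (w j) = j by have /andP[/eqP] := xchooseP (free j).
have we j x : e (w j) x -> b x = j.
  by have /andP[_ /forallP/(_ x)/implyP h] := xchooseP (free j) => /h/eqP.
pose i := Ordinal (b_lt u).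
have w_inj : injective w by move=> j j' ww; apply: val_inj; rewrite /= -!wb ww.
pose J := [set w j | j in [set~ i]].
have uJ x : b x = i -> x \notin J.
  move=> xi; apply/imsetP=> -[j]; rewrite !inE => ji xw.
  by case/eqP: ji; apply: val_inj; rewrite /= -(wb j) -xw xi.
have Jx x y : y \in J -> b x = i -> ~~ e x y.
  case/imsetP=> j; rewrite !inE => ji -> xi; rewrite e_sym.
  by apply: contra ji => /we xj; apply/eqP/val_inj; rewrite /= -xj xi.
have iv : b v = i by [].
have := stable_le (I := u |: (v |: J)).
rewrite !cardsU1 in_setU1 negb_or uv !uJ //= card_imset // cardsC1 card_ord.
have a_gt0 : 0 < a := leq_ltn_trans (leq0n _) (b_lt u).
suff st : stable_set (u |: (v |: J)) by move=> /(_ st); lia.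
move=> x y; rewrite !in_setU1 => /or3P[/eqP->|/eqP->|xJ] /or3P[/eqP->|/eqP->|yJ];
  rewrite ?e_irr //; try exact: Jx; try (by rewrite e_sym); try (by rewrite e_sym Jx).
case/imsetP: xJ yJ => j _ -> /imsetP[j' _ ->]; apply/negP=> ww.
by have := we _ _ ww; rewrite wb => jj; move: ww; rewrite (val_inj jj) e_irr.
Qed.
End SpreadBlocks.

(** The edge bound says that the average degree is at most [k - 1 + 2 / (k - 1)]. With the greedy
    inequality it gives [C + 2 * \sum_i d i ^+ 2 <= 4 * a], where [d] is the deviation of the block
    sizes from [k]. As [k > 2 * a], each block keeps a vertex without crossing edges, so the blocks
    are cliques, of size at most [k] and therefore exactly [k]. *)
Lemma clique_partition (k a : nat) :
  17 * a + 15 < 8 * k -> #|T| = k * a ->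
  (forall I, stable_set I -> #|I| <= a) ->
  (forall C : {set T}, {in C &, forall u v, u != v -> e u v} -> #|C| <= k) ->
  (k - 1) * \sum_u \sum_(v | e u v) 1 <= ((k - 1) ^ 2 + 2) * (k * a) ->
  exists b : T -> nat, [/\ forall u, b u < a,
    forall u v, b u = b v -> u != v -> e u v & forall i, i < a -> #|block b i| = k].
Proof.
move=> ka cardT stable_le clique_le E_le.
have [b [I [_ /stable_le Ia bI]]] := greedy_partition [set: T].
have b_lt u : b u < a by apply: leq_trans (bI u _) Ia.
have setTE (F : T -> T -> nat) : \sum_(u in [set: T]) \sum_(v in [set: T]) F u v =
    \sum_u \sum_v F u v.
  rewrite (eq_bigl predT) => [|u]; last by rewrite inE.
  by apply: eq_bigr => u _; apply: eq_bigl => v; rewrite inE.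
rewrite !setTE (sum_same_block b_lt) => bE; exists b.
have EE : \sum_u \sum_v e u v = \sum_u \sum_(v | e u v) 1.
  by apply: eq_bigr => u _; rewrite [RHS]big_mkcond; apply: eq_bigr => v _; case: (e u v).
rewrite EE in bE; set E := \sum_u _ in E_le bE.
set C := \sum_u _ in bE.
have sumT := sum_block_card b_lt; rewrite cardT in sumT.
have spread j : j < a -> C < 2 * #|block b j|.
  move=> ja; set s := fun i : 'I_a => #|block b i| in bE sumT.
  pose d (i : 'I_a) : int := ((s i)%:Z - k%:Z)%R.
  have sumZ : (\sum_i (s i)%:Z = (k * a)%N%:Z)%R.
    by rewrite -sumT -natz natr_sum; apply: eq_bigr => i _; rewrite natz.
  (* The sizes sum to [k * a], so the squared deviations measure the excess of
     [\sum_i s i * (s i).-1] over its balanced value [k * (k - 1) * a]. *)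
  have dev : (\sum_i d i ^+ 2 =
      (\sum_i s i * (s i).-1)%N%:Z + (k * a)%N%:Z - (k * k * a)%N%:Z)%R.
    have -> : ((k * k * a)%N%:Z = 2 * k%:Z * \sum_i (s i)%:Z - \sum_(i < a) k%:Z ^+ 2)%R.
      by rewrite sumZ sumr_const card_ord -mulr_natr natz; lia.
    rewrite -sumZ -natz natr_sum mulr_sumr opprB addrA -big_split /= [RHS]addrAC.
    rewrite -sumrB -big_split; apply: eq_bigr => i _ /=.
    by rewrite /d natz; case: (s i) => [|m] /=; lia.
  have dj : (d (Ordinal ja) ^+ 2 <= \sum_i d i ^+ 2)%R.
    by rewrite (bigD1 (Ordinal ja)) //= lerDl sumr_ge0 // => i _; rewrite sqr_ge0.
  rewrite dev /d /s /= in dj.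
  (* Rounding: dividing the bound by [k - 1] leaves a remainder [2 * a], which is less than
     [k - 1]. *)
  have E_le' : E <= k * k * a - k * a + 2 * a.
    move: E_le ka; case: (k) => [|m]; first by lia.
    rewrite subn1 /= => E_le ka; rewrite leqNgt; apply/negP=> E_gt.
    have : m * (m.+1 * m * a + 2 * a).+1 <= m * E by rewrite leq_mul2l; apply/orP; right; lia.
    by move/leq_trans => /(_ _ E_le); nia.
  (* For integers the deficit [k - #|block b j|] is at most its square, so [C >= 2 * #|block b j|]
     would force [k <= 2 * a]. *)
  have sq (x : int) : (- x <= x ^+ 2)%R.
    have [x0|x0] := lerP 0%R x; first by rewrite (@le_trans _ _ 0%R) ?sqr_ge0 ?oppr_le0.
    by rewrite expr2 -mulrNN ler_peMr; lia.
  have := le_trans (sq _) dj; rewrite ltnNge; apply/contraTN => sC.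
  have : k * a <= k * k * a by rewrite leq_mul2r leq_pmulr ?orbT; lia.
  clear E_le; move: bE ka E_le' sC; move: (\sum_i _) E C #|_| (k * a) (k * k * a) => S0 E0 C0 s0 p q.
  by clear; lia.
have clique := spread_block_clique b_lt spread stable_le.
have blk_le i : #|block b i| <= k.
  by apply: clique_le => u v; rewrite !inE => /eqP ui /eqP vi; apply: clique; rewrite ui vi.
split=> // i ia; apply/eqP; rewrite eqn_leq blk_le /= leqNgt; apply/negP=> lt.
suff : \sum_(j < a) #|block b j| < \sum_(j < a) k.
  by rewrite sumT sum_nat_const card_ord mulnC ltnn.
rewrite (bigD1 (Ordinal ia)) //= [X in _ < X](bigD1 (Ordinal ia)) //=.
by rewrite -addSn leq_add // leq_sum.
Qed.
End CliquePartition.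

(** * Numbering the blocks *)

Section TreeOrder.
Variables (V : finType) (q : rel V).
Hypothesis q_sym : symmetric q.

(** Connectivity of the graph induced on [U], phrased with cuts so that no paths inside [U] have to
    be handled. *)
Definition cut_connected (U : {set V}) :=
  forall W : {set V}, W \proper U -> W != set0 ->
  exists x y, [/\ x \in W, y \in U :\: W & q x y].

Lemma cut_connected_addv (W : {set V}) x y :
  cut_connected W -> y \in W -> q x y -> cut_connected (x |: W).
Proof.
move=> connW yW xy Z ZU /set0Pn[z zZ].
have [xW|xW] := boolP (x \in W).
  have xWW : x |: W = W by apply/setUidPr; rewrite sub1set.
  by rewrite xWW in ZU *; apply: connW => //; apply/set0Pn; exists z.
have [yZ|yZ] := boolP (y \in Z).
  have [WZ|WZ] := boolP (W \subset Z).
    have xZ : x \notin Z.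
      by apply: contraL ZU => xZ; rewrite properE subUset sub1set xZ WZ andbF.
    by exists y, x; split; rewrite ?inE ?eqxx ?xZ // q_sym.
  have [||z1 [z2 []]] := connW (Z :&: W).
  - rewrite properE subsetIr; apply: contra WZ => /subset_trans; apply.
    exact: subsetIl.
  - by apply/set0Pn; exists y; rewrite inE yZ.
  rewrite !inE => /andP[z1Z _] /andP[z2Z z2W] z12.
  by exists z1, z2; split=> //; rewrite !inE z2W orbT andbT; move: z2Z; rewrite z2W andbT.
have [xZ|xZ] := boolP (x \in Z).
  by exists x, y; split; rewrite // !inE yZ yW orbT.
have ZW : Z \subset W.
  apply/subsetP=> u uZ; have := subsetP (proper_sub ZU) u uZ.
  by rewrite in_setU1 => /predU1P[ux|//]; rewrite -ux uZ in xZ.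
have [||z1 [z2 []]] := connW Z.
- by rewrite properE ZW; apply: contra yZ => /subsetP; apply.
- by apply/set0Pn; exists z.
rewrite !inE => z1Z /andP[z2Z z2W] z12.
by exists z1, z2; split=> //; rewrite !inE z2Z z2W orbT.
Qed.

Lemma cut_connected_noncut (U : {set V}) w : cut_connected U -> w \in U -> 1 < #|U| ->
  exists x, [/\ x \in U, x != w & cut_connected (U :\ x)].
Proof.
move=> connU wU U1.
have conn1 : cut_connected [set w].
  move=> W; rewrite properEcard cards1 ltnS leqn0 cards_eq0 => /andP[_ /eqP->].
  by rewrite eqxx.
(* By induction a connected proper part containing [w] grows until it misses
   a single vertex. *)
suff grow m (W : {set V}) : #|U| - #|W| <= m -> W \proper U -> w \in W ->
    cut_connected W -> exists x, [/\ x \in U, x != w & cut_connected (U :\ x)].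
  apply: (grow #|U| [set w]); rewrite ?leq_subr ?set11 //.
  by rewrite properEcard sub1set wU cards1.
elim: m W => [|m IH] W Wm WU wW connW.
  by have := proper_card WU; lia.
have [|x [y [xW]]] := connU _ WU; first by apply/set0Pn; exists w.
rewrite inE => /andP[yW yU] xy.
have connyW : cut_connected (y |: W).
  by apply: cut_connected_addv connW xW _; rewrite q_sym.
have yWU : y |: W \subset U by rewrite subUset sub1set yU proper_sub.
have [yWE|yWE] := eqVneq (y |: W) U.
  exists y; split=> //; first by apply: contraNneq yW => ->.
  by rewrite -yWE setU1K.
apply: (IH (y |: W)) => //; last by rewrite in_setU1 wW orbT.
  by move: Wm; rewrite cardsU1 yW; clear; lia.
by rewrite properEneq yWE.
Qed.

(* Vertices are numbered by removing non-cut vertices, largest number first; the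
   next vertex removed is chosen distinct from a neighbour of the last one. *)
Lemma cut_connected_order (U : {set V}) w : cut_connected U -> w \in U ->
  exists f : V -> nat, [/\ {in U &, injective f}, {in U, forall u, f u < #|U|},
    {in U, forall u, 0 < f u -> exists v, [/\ v \in U, q u v & f v <= (f u).-2]} &
    1 < #|U| -> f w != #|U|.-1].
Proof.
move: {2}#|U| (leqnn #|U|) => m; elim: m U w => [|m IH] U w.
  by rewrite leqn0 cards_eq0 => /eqP->; rewrite inE.
move=> Um connU wU; have [U1|U1] := leqP #|U| 1.
  have /cards1P[x Ux] : #|U| == 1.
    by rewrite eqn_leq U1 card_gt0; apply/set0Pn; exists w.
  exists (fun=> 0); split=> // [u v|u]; rewrite Ux ?cards1 //.
  by move=> /set1P-> /set1P->.
have [x [xU xw connx]] := cut_connected_noncut connU wU U1.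
have cardU : #|U| = #|U :\ x|.+1 by rewrite (cardsD1 x) xU.
(* The neighbour [y] of the removed vertex [x] is protected in the recursive call: it is not
   numbered last in [U :\ x], so it lies at least two below [x]. If [U :\ x] is a singleton, the
   truncated [.-2] is 0, as is the number of [y]. *)
have [||x' [y []]] := connU [set x].
- by rewrite properEcard sub1set xU cards1.
- by apply/set0Pn; exists x; rewrite set11.
move=> /set1P-> yU xy.
have [|f [f_inj f_lt f_par f_y]] := IH (U :\ x) y _ connx yU; first by lia.
exists (fun u => if u == x then #|U :\ x| else f u).
have inUx u : u \in U -> u != x -> u \in U :\ x by move=> uU ux; rewrite in_setD1 ux.
split.
- move=> u v uU vU; case: eqVneq => [->|ux]; case: eqVneq => [->|vx] //.
  + by move=> E; have := f_lt v (inUx _ vU vx); rewrite -E ltnn.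
  + by move=> E; have := f_lt u (inUx _ uU ux); rewrite E ltnn.
  + by apply: f_inj; apply: inUx.
- move=> u uU; case: eqVneq => [_|ux]; rewrite cardU //.
  by rewrite ltnS ltnW // f_lt ?inUx.
- move=> u uU; case: eqVneq => [->|ux] => [c_gt0|].
    exists y; have := yU; rewrite in_setD1 => /andP[yx yU']; split=> //.
    rewrite (negPf yx); have := f_lt y yU.
    have [/f_y/eqP|] := ltnP 1 #|U :\ x|; first by clear; lia.
    by clear; lia.
  move=> /(f_par u (inUx _ uU ux))[v [vU uv fv]]; exists v.
  by move: vU; rewrite in_setD1 => /andP[vx vU]; rewrite (negPf vx).
- move=> _; rewrite eq_sym in xw; rewrite (negPf xw) cardU /= neq_ltn.
  by rewrite f_lt // inUx.
Qed.
End TreeOrder.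

(** The ordering is applied to the quotient graph on the blocks. For [i = 1] the truncated [i.-2] is
    0. *)
Lemma block_order n a (e : rel 'I_n) (b : 'I_n -> nat) :
  symmetric e -> connected_graph e -> (forall u, b u < a) ->
  (forall i, i < a -> exists u, b u = i) ->
  exists c : 'I_n -> nat, [/\ forall u, c u < a, forall u v, (c u == c v) = (b u == b v) &
    forall i, 0 < i < a -> exists u v, [/\ c u = i, e u v & c v <= i.-2]].
Proof.
move=> e_sym e_conn b_lt b_onto.
pose B u := Ordinal (b_lt u).
pose q (i j : 'I_a) := [exists u, exists v, [&& B u == i, B v == j & e u v]].
have qP i j : reflect (exists u v, [/\ B u = i, B v = j & e u v]) (q i j).
  apply: (iffP existsP) => [[u /existsP[v /and3P[/eqP ? /eqP ? ?]]]|[u [v [ui vj uv]]]].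
    by exists u, v.
  by exists u; apply/existsP; exists v; rewrite ui vj !eqxx.
have q_sym : symmetric q.
  by move=> i j; apply/qP/qP=> -[u [v [? ? ?]]]; exists v, u; rewrite e_sym.
case: (posnP a) => [a0|a_gt0].
  exists b; split=> // i; first by rewrite a0 ltn0 andbF.
have connq : cut_connected q setT.
  move=> W WT /set0Pn[i iW].
  have /properP[_ [j _ jW]] := WT.
  have [u ui] := b_onto _ (ltn_ord i); have [v vj] := b_onto _ (ltn_ord j).
  have Bu : B u = i by apply: val_inj.
  have Bv : B v = j by apply: val_inj.
  have [/existsP[x /existsP[y /and3P[xW yW xy]]]|nex] :=
      boolP [exists x, exists y, [&& B x \in W, B y \notin W & e x y]].
    by exists (B x), (B y); split=> //; [rewrite !inE yW | apply/qP; exists x, y].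
  (* If no edge left [W], the vertices in the blocks of [W] would be closed under adjacency in a
     connected graph. *)
  have cl : closed e [pred x | B x \in W].
    apply: (intro_closed (sym_connect_sym e_sym)) => x y xy.
    rewrite !inE => xW; apply: contraR nex => yW.
    by apply/existsP; exists x; apply/existsP; exists y; rewrite xW yW.
  have := closed_connect cl (e_conn u v).
  by rewrite !inE Bu Bv iW (negPf jW).
have [f [f_inj f_lt f_par _]] := cut_connected_order q_sym connq (in_setT (Ordinal a_gt0)).
have f_onto i : i < a -> exists j, f j = i.
  move=> ia; have g_lt j : f j < a.
    by have := f_lt j (in_setT _); rewrite cardsT card_ord.
  have g_inj : injective (fun j => Ordinal (g_lt j)).
    by move=> j j' [fjj]; apply: f_inj fjj; rewrite in_setT.
  have [h _ hK] := injF_bij g_inj; exists (h (Ordinal ia)).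
  by have /(congr1 val) := hK (Ordinal ia).
exists (f \o B); split=> [u|u v|i /andP[i0 ia]] /=.
- by have := f_lt (B u) (in_setT _); rewrite cardsT card_ord.
- by rewrite (inj_in_eq f_inj) ?in_setT // -val_eqE.
- have [j fj] := f_onto i ia.
  have [|j' [_ /qP[u [v [uj vj uv]]] fj']] := f_par j (in_setT _); first by rewrite fj.
  by exists u, v; rewrite uj vj fj -fj.
Qed.

Local Open Scope ring_scope.

(** * Spectral radius and Rayleigh quotients *)

(** The variational form of the spectral radius: a bound on the quadratic form, attained at a
    nonnegative eigenvector. Over an ordered field it determines [l], and it lets the later
    arguments avoid complex numbers. *)
Definition rayleigh_max (R : numDomainType) (n : nat) (e : rel 'I_n) (l : R) :=
  (forall x : 'I_n -> R,
     \sum_i x i * \sum_(j | e i j) x j <= l * \sum_i x i ^+ 2) /\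
  (exists x : 'I_n -> R, [/\ forall i, 0 <= x i, exists i, 0 < x i &
     forall i, \sum_(j | e i j) x j = l * x i]).

Section SymmetricSpectrum.
Local Open Scope sesquilinear_scope.
Variables (n : nat) (A : 'M[algC]_n).
Hypothesis Aherm : A \is hermsymmx.

Let P := spectralmx A.
Let d := spectral_diag A.

Let PPt : P *m P^t* = 1%:M.
Proof. exact/unitarymxP/spectral_unitarymx. Qed.

Let PtP : P^t* *m P = 1%:M.
Proof. exact: mulmx1C. Qed.

Lemma spectral_decompE : A = P^t* *m diag_mx d *m P.
Proof.
rewrite -invmx_unitary ?spectral_unitarymx //.
exact/orthomx_spectralP/hermitian_normalmx.
Qed.

Lemma spectral_coordE (x : 'rV_n) : x *m A *m P^t* = x *m P^t* *m diag_mx d.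
Proof. by rewrite {1}spectral_decompE !mulmxA -[_ *m P *m _]mulmxA PPt mulmx1. Qed.

Lemma row_spectralmx_eigen i : row i P *m A = d 0 i *: row i P.
Proof.
rewrite {1}spectral_decompE !mulmxA -row_mul PPt -row_mul mul1mx -row_mul.
by apply/rowP=> j; rewrite mxE mul_diag_mx !mxE.
Qed.

Lemma row_spectralmx_neq0 i : row i P != 0.
Proof.
apply/eqP=> /(congr1 (mulmx^~ (P^t*))); rewrite -row_mul PPt mul0mx.
by move=> /rowP/(_ i)/eqP; rewrite !mxE eqxx oner_eq0.
Qed.

Lemma mem_spec_roots z : (z \in spec_roots A) = [exists i, d 0 i == z].
Proof.
have -> : (z \in spec_roots A) = root (char_poly A) z.
  rewrite /spec_roots; case: closed_field_poly_normal => s /= ->.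
  by rewrite (monicP (char_poly_monic A)) scale1r root_prod_XsubC.
rewrite -eigenvalue_root_char; apply/eigenvalueP/existsP.
  case=> v vA v0; have: v *m P^t* != 0.
    by apply: contraNneq v0 => vP; rewrite -[v]mulmx1 -PtP mulmxA vP mul0mx.
  case/rV0Pn=> i vi; exists i; apply/eqP/(mulIf vi).
  have := spectral_coordE v; rewrite vA -scalemxAl => /rowP/(_ i).
  by rewrite mul_mx_diag !mxE => ->; rewrite mulrC.
by case=> i /eqP <-; exists (row i P); rewrite ?row_spectralmx_neq0 ?row_spectralmx_eigen.
Qed.

Lemma norm_spectral_diag_le i : `|d 0 i| <= spectral_radius A.
Proof.
have : d 0 i \in spec_roots A by rewrite mem_spec_roots; apply/existsP; exists i.
rewrite /spectral_radius; elim: (spec_roots A) => // z s IH.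
(* [algC] is only partially ordered; maxima behave well here because norms are real. *)
have smax : \big[Num.max/0]_(y <- s) `|y| \is Num.real.
  by apply: bigmax_real => [|y _]; rewrite ?real0 ?normr_real.
rewrite big_cons inE comparable_le_max ?real_comparable ?normr_real // => /predU1P[->|/IH->].
  by rewrite lexx.
by rewrite orbT.
Qed.

Lemma spectral_radius_attained : (0 < n)%N -> exists i, `|d 0 i| = spectral_radius A.
Proof.
move=> n_gt0; have : spec_roots A != [::].
  suff : d 0 (Ordinal n_gt0) \in spec_roots A by case: spec_roots.
  by rewrite mem_spec_roots; apply/existsP; eexists.
suff H (s : seq algC) : s != [::] -> exists2 z, z \in s & `|z| = \big[Num.max/0]_(y <- s) `|y| :> algC.
  by case/H=> z; rewrite mem_spec_roots => /existsP[i /eqP<-] zE; exists i; exact: zE.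
elim: s => // z [|y s] IH _.
  by exists z; rewrite ?inE // big_cons big_nil max_l.
have [//|t ts tE] := IH; rewrite big_cons -tE /Num.max.
by case: ifP => _; [exists t; rewrite // inE ts orbT | exists z; rewrite ?inE ?eqxx].
Qed.

Lemma quad_spectralE (x : 'rV_n) :
  (x *m A *m x^t*) 0 0 = \sum_i d 0 i * `|(x *m P^t*) 0 i| ^+ 2.
Proof.
rewrite {1}spectral_decompE !mulmxA mul_mx_diag.
rewrite -[_ *m P *m _]mulmxA mxE; apply: eq_bigr => i _.
have -> : P *m x^t* = (x *m P^t*)^t* by rewrite trmx_mul map_mxM trmxCK.
by rewrite !mxE normCK; ring.
Qed.

Lemma sqnorm_spectralE (x : 'rV_n) :
  \sum_i `|x 0 i| ^+ 2 = \sum_i `|(x *m P^t*) 0 i| ^+ 2.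
Proof.
have sq (y : 'rV[algC]_n) : \sum_i `|y 0 i| ^+ 2 = (y *m y^t*) 0 0.
  by rewrite mxE; apply: eq_bigr => i _; rewrite !mxE normCK.
by rewrite !sq trmx_mul map_mxM trmxCK mulmxA -[_ *m _ *m P]mulmxA PtP mulmx1.
Qed.

Let d_real i : d 0 i \is Num.real.
Proof. exact/mxOverP/hermitian_spectral_diag_real. Qed.

Lemma quad_le_spectral_radius (x : 'rV_n) :
  (x *m A *m x^t*) 0 0 <= spectral_radius A * \sum_i `|x 0 i| ^+ 2.
Proof.
rewrite quad_spectralE sqnorm_spectralE mulr_sumr; apply: ler_sum => i _.
rewrite ler_wpM2r ?exprn_ge0 //.
exact: le_trans (real_ler_norm (d_real i)) (norm_spectral_diag_le i).
Qed.

(** In the eigenbasis, equality in the Rayleigh bound kills every coordinate whose eigenvalue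
    differs from the spectral radius. *)
Lemma quad_eq_spectral_radius (x : 'rV_n) :
  (x *m A *m x^t*) 0 0 = spectral_radius A * \sum_i `|x 0 i| ^+ 2 ->
  x *m A = spectral_radius A *: x.
Proof.
rewrite quad_spectralE sqnorm_spectralE mulr_sumr => eqs.
suff E : x *m P^t* *m diag_mx d = spectral_radius A *: (x *m P^t*).
  by rewrite -[LHS]mulmx1 -PtP mulmxA spectral_coordE E -scalemxAl -mulmxA PtP mulmx1.
apply/rowP=> i; rewrite mul_mx_diag !mxE mulrC.
have [->|xi] := eqVneq (\sum_j x 0 j * P^t* j i) 0; first by rewrite !mulr0.
congr (_ * _); apply/eqP; rewrite -subr_eq0.
have /eqP : \sum_j (spectral_radius A - d 0 j) * `|(x *m P^t*) 0 j| ^+ 2 = 0.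
  by under eq_bigr do rewrite mulrBl; rewrite sumrB eqs subrr.
have dge j : 0 <= (spectral_radius A - d 0 j) * `|(x *m P^t*) 0 j| ^+ 2.
  rewrite mulr_ge0 ?exprn_ge0 // subr_ge0.
  exact: le_trans (real_ler_norm (d_real j)) (norm_spectral_diag_le j).
rewrite psumr_eq0 // => /allP/(_ i (mem_index_enum _)) /=.
rewrite mulf_eq0 expf_eq0 normr_eq0 mxE (negPf xi) andbF orbF.
by rewrite !subr_eq0 eq_sym.
Qed.
End SymmetricSpectrum.

(** The Perron argument: take an eigenvector for an eigenvalue of largest modulus and replace its
    entries by their norms. By the triangle inequality the result still attains the Rayleigh bound,
    so it is an eigenvector for the spectral radius itself. *)
Lemma lambda_rayleigh_max n (e : rel 'I_n) : (0 < n)%N -> symmetric e ->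
  exists2 l : algR, algRval l = lambda e & rayleigh_max e l.
Proof.
move=> n_gt0 syme.
have Areal : adjmx e \is a mxOver Num.real.
  by apply/mxOverP=> i j; rewrite mxE realn.
have Aherm : adjmx e \is hermsymmx.
  apply: realsym_hermsym => //; apply/is_hermitianmxP.
  by rewrite expr0 scale1r map_mx_id //; apply/matrixP=> i j; rewrite !mxE syme.
have quadE (x : 'rV[algC]_n) : (x *m adjmx e *m (map_mx Num.conj x^T)) 0 0 =
    \sum_i (x 0 i)^* * \sum_(j | e i j) x 0 j.
  rewrite mxE; apply: eq_bigr => i _; rewrite !mxE mulrC; congr (_ * _).
  rewrite [RHS]big_mkcond; apply: eq_bigr => j _; rewrite mxE syme.
  by case: (e i j); rewrite ?mulr1 ?mulr0.
have [i0 i0E] := spectral_radius_attained Aherm n_gt0.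
have lR : lambda e \is Creal by rewrite /lambda -i0E normr_real.
exists (in_algR lR) => //; split=> [x|].
  pose y : 'rV[algC]_n := \row_i algRval (x i).
  have yC i : (y 0 i)^* = algRval (x i) by rewrite mxE; apply/CrealP/algRvalP.
  have := quad_le_spectral_radius Aherm y; rewrite quadE.
  have -> : \sum_i `|y 0 i| ^+ 2 = algRval (\sum_i x i ^+ 2).
    rewrite rmorph_sum; apply: eq_bigr => i _.
    by rewrite normCK yC mxE rmorphXn expr2.
  have -> : \sum_i (y 0 i)^* * \sum_(j | e i j) y 0 j =
     algRval (\sum_i x i * \sum_(j | e i j) x j).
    rewrite rmorph_sum; apply: eq_bigr => i _; rewrite rmorphM yC rmorph_sum.
    by congr (_ * _); apply: eq_bigr => j _; rewrite mxE.
  by [].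
pose v := row i0 (spectralmx (adjmx e)).
pose w : 'rV[algC]_n := \row_i `|v 0 i|.
have wC i : (w 0 i)^* = w 0 i by rewrite mxE; apply/CrealP/normr_real.
have vE := row_spectralmx_eigen Aherm i0.
have wn : \sum_i `|w 0 i| ^+ 2 = \sum_i `|v 0 i| ^+ 2.
  by apply: eq_bigr => i _; rewrite mxE normr_id.
have wmax : (w *m adjmx e *m (map_mx Num.conj w^T)) 0 0 =
    spectral_radius (adjmx e) * \sum_i `|w 0 i| ^+ 2.
  apply/eqP; rewrite eq_le (quad_le_spectral_radius Aherm) /=.
  have -> : spectral_radius (adjmx e) * \sum_i `|w 0 i| ^+ 2 =
     `|(v *m adjmx e *m (map_mx Num.conj v^T)) 0 0|.
    rewrite wn -i0E vE -scalemxAl mxE normrM; congr (_ * _).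
    rewrite [in RHS]mxE ger0_norm; last first.
      by rewrite sumr_ge0 // => i _; rewrite !mxE -normCK exprn_ge0.
    by apply: eq_bigr => i _; rewrite !mxE normCK.
  rewrite !quadE; apply: le_trans (ler_norm_sum _ _ _) _.
  apply: ler_sum => i _; rewrite wC normrM norm_conjC [w 0 i]mxE ler_wpM2l //.
  apply: le_trans (ler_norm_sum _ _ _) _.
  by apply: ler_sum => j _; rewrite [w 0 j]mxE.
have := quad_eq_spectral_radius Aherm wmax => wA.
exists (fun i => in_algR (normr_real (v 0 i))); split=> [i||i].
- exact: (normr_ge0 (v 0 i)).
- have /rV0Pn[i vi] := row_spectralmx_neq0 (adjmx e) i0.
  by exists i; change (0 < `|v 0 i|); rewrite normr_gt0.
- apply: val_inj; rewrite /= rmorph_sum /=.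
  move/rowP: wA => /(_ i); rewrite [LHS]mxE [RHS]mxE [w 0 i]mxE => <-.
  rewrite big_mkcond; apply: eq_bigr => j _; rewrite [w 0 j]mxE [adjmx e j i]mxE.
  by rewrite syme; case: (e j i); rewrite ?mulr1 ?mulr0.
Qed.

(** * Standard test vectors and invariance under isomorphism *)

Section RayleighBounds.
Variable R : realFieldType.

Lemma sum_sqr_gt0 (I : finType) (x : I -> R) i : 0 < x i -> 0 < \sum_j x j ^+ 2.
Proof.
move=> xi; rewrite (bigD1 i) //= ltr_wpDr ?exprn_gt0 //.
by rewrite sumr_ge0 // => j _; rewrite sqr_ge0.
Qed.

Lemma rayleigh_max_iso_le n (e1 e2 : rel 'I_n) (l1 l2 : R) :
  graph_iso e1 e2 -> rayleigh_max e1 l1 -> rayleigh_max e2 l2 -> l1 <= l2.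
Proof.
move=> [f [[g fK gK] fE]] [_ [x [x0 [i xi] xE]]] [le2 _].
have injf : injective f := can_inj fK.
have := le2 (x \o g).
rewrite (reindex_inj injf) /= [X in _ <= _ * X](reindex_inj injf) /=.
under eq_bigr => u _ do rewrite (reindex_inj injf) /=.
under eq_bigr => u _.
  under eq_bigl do rewrite fE.
  under eq_bigr do rewrite fK.
  rewrite fK xE mulrCA -expr2; over.
under [X in _ <= _ * X]eq_bigr do rewrite fK.
by rewrite -mulr_sumr ler_pM2r // (sum_sqr_gt0 xi).
Qed.

Lemma graph_iso_sym n (e1 e2 : rel 'I_n) : graph_iso e1 e2 -> graph_iso e2 e1.
Proof.
by move=> [f [[g fK gK] fE]]; exists g; split=> [|x y]; [exists f | rewrite -fE !gK].
Qed.

Lemma rayleigh_max_iso n (e1 e2 : rel 'I_n) (l1 l2 : R) :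
  graph_iso e1 e2 -> rayleigh_max e1 l1 -> rayleigh_max e2 l2 -> l1 = l2.
Proof.
move=> iso m1 m2; apply/le_anti; rewrite (rayleigh_max_iso_le iso m1 m2).
exact: rayleigh_max_iso_le (graph_iso_sym iso) m2 m1.
Qed.

(** The test vector is the indicator of the clique. *)
Lemma rayleigh_max_clique n (e : rel 'I_n) (l : R) (C : {set 'I_n}) :
  rayleigh_max e l -> irreflexive e -> (0 < #|C|)%N ->
  {in C &, forall u v, u != v -> e u v} -> #|C|%:R <= l + 1.
Proof.
move=> [le _] irr C0 cl; have := le (fun u => (u \in C)%:R).
have cardE (D : {set 'I_n}) : #|D|%:R = \sum_v (v \in D)%:R :> R.
  rewrite -sumr_const big_mkcond.
  by apply: eq_bigr => v _; case: (v \in D).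
have -> : \sum_u ((u \in C)%:R : R) ^+ 2 = #|C|%:R.
  by rewrite cardE; apply: eq_bigr => u _; case: (u \in C); rewrite ?expr1n ?expr0n.
have -> : \sum_u (u \in C)%:R * \sum_(v | e u v) ((v \in C)%:R : R)
    = \sum_(u in C) (#|C|%:R - 1).
  rewrite [RHS]big_mkcond; apply: eq_bigr => u _.
  case: ifP => uC; rewrite ?mul0r // mul1r (cardsD1 u) uC natrD addrAC subrr add0r.
  rewrite cardE big_mkcond; apply: eq_bigr => v _; rewrite in_setD1.
  have [->|neq] := eqVneq v u; first by rewrite irr.
  have [vC|_] := boolP (v \in C); last by case: (e u v).
  by rewrite (cl u v) // eq_sym.
rewrite sumr_const -[(_ - 1) *+ _]mulr_natr ler_pM2r ?ltr0n //; lra.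
Qed.

(** The test vector is constant. *)
Lemma rayleigh_max_degree n (e : rel 'I_n) (l : R) :
  rayleigh_max e l -> (\sum_u \sum_(v | e u v) 1)%N%:R <= l * n%:R.
Proof.
move=> [le _]; have := le (fun=> 1).
have -> : \sum_(u < n) (1 : R) ^+ 2 = n%:R.
  by rewrite expr1n sumr_const card_ord.
congr (_ <= _); rewrite natr_sum; apply: eq_bigr => u _.
by rewrite mul1r natr_sum.
Qed.
End RayleighBounds.

(** * Perron weights of the clique path *)

(** Halving lists the indices of the first half twice (a middle one once); symmetry moves one copy
    to the second half. *)
Lemma sum_half (R : nmodType) (N : nat) (h : nat -> R) :
  (forall r, (r < N)%N -> h (N.-1 - r)%N = h r) ->
  \sum_(j < N) h j./2 = \sum_(r < N) h r.
Proof.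
elim/ltn_ind: N h => -[|[|N]] IH h hsym; rewrite ?big_ord0 ?big_ord1 //.
rewrite big_ord_recl [in RHS]big_ord_recl big_ord_recl big_ord_recr /=.
have -> : h N.+1 = h 0%N by rewrite -(hsym N.+1) //= subnn.
congr (_ + _); rewrite addrC; congr (_ + _).
rewrite -(IH N _ (fun r => h r.+1)) // => r rN.
rewrite -(hsym r.+1); last by lia.
by congr h; move: rN => /=; lia.
Qed.

Section PathWeights.
Variables (R : realFieldType) (t : R).

(** This is [x * (x + t * y) + y * (y + t * x)], the contribution of one crossing edge between
    blocks of weights [x] and [y]. *)
Definition edge_form (x y : R) := x ^+ 2 + y ^+ 2 + t * x * y *+ 2.

Definition path_eigen (N : nat) (K : R) (s : nat -> R) :=
  forall r, (r <= N)%N -> K * s r =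
    (if (r < N)%N then s r + t * s r.+1 else 0) +
    (if (0 < r)%N then s r + t * s r.-1 else 0).

Variables (N : nat) (K : R) (s : nat -> R).
Hypothesis sE : path_eigen N K s.

Lemma path_eigen_summation (w : nat -> R) :
  \sum_(r < N.+1) w r * (K * s r) =
  \sum_(r < N) (w r * (s r + t * s r.+1) + w r.+1 * (s r.+1 + t * s r)).
Proof.
transitivity (\sum_(r < N.+1) ((if (r < N)%N then w r * (s r + t * s r.+1) else 0) +
    (if (0 < r)%N then w r * (s r + t * s r.-1) else 0))).
  apply: eq_bigr => r _; rewrite sE; last by rewrite -ltnS.
  by rewrite mulrDr; congr (_ + _); case: ifP => _; rewrite ?mulr0.
rewrite big_split [in RHS]big_split; congr (_ + _).
  by rewrite big_ord_recr /= ltnn addr0; apply: eq_bigr => r _; rewrite ltn_ord.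
by rewrite big_ord_recl /= add0r.
Qed.

Lemma path_eigen_quad :
  K * \sum_(r < N.+1) s r ^+ 2 = \sum_(r < N) edge_form (s r) (s r.+1).
Proof.
transitivity (\sum_(r < N.+1) s r * (K * s r)).
  by rewrite mulr_sumr; apply: eq_bigr => r _; ring.
by rewrite path_eigen_summation; apply: eq_bigr => r _; rewrite /edge_form; ring.
Qed.

Hypothesis t_gt0 : 0 < t.
Hypothesis s_ge0 : forall r, (r <= N)%N -> 0 <= s r.
Hypothesis s_neq0 : exists2 r, (r <= N)%N & 0 < s r.

(** Summing the equations counts each [s r] with factor [t + 1] once per incident edge, that is at
    most twice. *)
Lemma path_eigen_le : K <= 2 * t + 2.
Proof.
have S_gt0 : 0 < \sum_(r < N.+1) s r.
  have [r rN sr] := s_neq0; rewrite (bigD1 (inord r)) //= inordK // ltr_wpDr //.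
  by rewrite sumr_ge0 // => i _; rewrite s_ge0 // -ltnS.
rewrite -(ler_pM2r S_gt0) mulr_sumr.
have := path_eigen_summation (fun=> 1); under eq_bigr do rewrite mul1r.
move=> ->; have sN := s_ge0 (leqnn N); have s0 := s_ge0 (leq0n N).
have -> : (2 * t + 2) * \sum_(r < N.+1) s r =
   (t + 1) * (\sum_(r < N) (s r + s r.+1) + (s 0%N + s N)).
  have -> : \sum_(r < N) (s r + s r.+1) =
      (\sum_(r < N.+1) s r - s N) + (\sum_(r < N.+1) s r - s 0%N).
    rewrite big_split; congr (_ + _); first by rewrite big_ord_recr addrK.
    by rewrite big_ord_recl addrC addKr.
  by ring.
rewrite mulrDr mulr_sumr.
under eq_bigr => r _.
  rewrite (_ : _ + _ = (t + 1) * (s r + s r.+1)); last by ring.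
  over.
by rewrite lerDl mulr_ge0 ?addr_ge0 // ltW.
Qed.

Hypothesis s_sym : forall r, (r <= N)%N -> s (N - r)%N = s r.

(** At an interior vertex [K <= 2 * t + 2] turns the equation into concavity, so increments decrease
    along the path. *)
Lemma path_eigen_monotone r : (r.*2 < N)%N -> s r <= s r.+1.
Proof.
have K_le := path_eigen_le.
have concave i : (i.+2 <= N)%N -> s i.+2 - s i.+1 <= s i.+1 - s i.
  move=> iN; have := sE (ltnW iN); rewrite iN /= => E.
  have s1 := s_ge0 (ltnW iN).
  have : t * (s i + s i.+2) <= t * (2 * s i.+1) by nra.
  by rewrite ler_pM2l //; lra.
have diff i j : (i + j.+1 <= N)%N -> s (i + j).+1 - s (i + j)%N <= s i.+1 - s i.
  elim: j => [|j IH] ij; first by rewrite addn0.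
  apply: le_trans (IH _); last by lia.
  by rewrite addnS; apply: concave; lia.
(* The increment at [r] dominates its mirror image, which by symmetry is its negative. *)
move=> rN; have := @diff r (N.-1 - r.*2)%N _.
have -> : (r + (N.-1 - r.*2))%N = (N - r.+1)%N by lia.
have -> : (N - r.+1).+1 = (N - r)%N by lia.
rewrite !s_sym; [|lia|lia].
by move=> /(_ ltac:(lia)); lra.
Qed.

Lemma path_eigen_monotone_half i j : (i <= j)%N -> (j.*2 <= N.+1)%N -> s i <= s j.
Proof.
move=> /subnK <-; elim: (j - i)%N => [|d IH] //; rewrite addSn => dN.
by apply: le_trans (IH _) (path_eigen_monotone _); lia.
Qed.

(** By monotonicity [s 0] is the value to examine; if it were zero, the equation would propagate the
    zero along the whole path. *)
Lemma path_eigen_gt0 r : (r.*2 <= N.+1)%N -> 0 < s r.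
Proof.
move=> rN; apply: lt_le_trans (path_eigen_monotone_half (leq0n r) rN).
rewrite lt0r s_ge0 // andbT; apply/eqP=> s0.
have zero i : (i <= N)%N -> s i = 0.
  elim/ltn_ind: i => -[|i] IH iN //.
  have := sE (ltnW iN); rewrite iN IH ?mulr0 ?add0r; [|lia|lia].
  have si1 := s_ge0 iN.
  case: i IH iN si1 => [|i] IH iN si1 /=.
    by rewrite addr0 => /esym/eqP; rewrite mulf_eq0 gt_eqF //= => /eqP.
  rewrite (IH i) ?mulr0 ?addr0; [|lia|lia].
  by move=> /esym/eqP; rewrite mulf_eq0 gt_eqF //= => /eqP.
by have [i iN] := s_neq0; rewrite zero // ltxx.
Qed.

(* Listing the vertices of the path from its centre outwards, alternately on both
   sides, makes the weights decrease; the vertex at index [i] is then attached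
   to the one at index [i - 2] (and index 1 to index 0). *)
Definition zigzag (j : nat) : R := s (N - j)./2.

Lemma zigzag_gt0 j : 0 < zigzag j.
Proof. by apply: path_eigen_gt0; lia. Qed.

Lemma zigzag_decr i j : (i <= j)%N -> zigzag j <= zigzag i.
Proof. by move=> ij; apply: path_eigen_monotone_half; lia. Qed.

(** The bound on [j] excludes the two ends of the path. Index 0 has neighbours 1 and 2; for [j = 1]
    the truncated [j.-2] is 0. *)
Lemma zigzag_eigen j : (j.+2 <= N)%N ->
  K * zigzag j = 2 * zigzag j + t * zigzag j.+2 + t * zigzag (if j is 0 then 1 else j.-2)%N.
Proof.
move=> jN; rewrite /zigzag sE; last by lia.
have [r rE] : {r | ((N - j)./2 = r.+1)%N} by exists ((N - j)./2).-1; lia.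
have -> : ((N - j.+2)./2 = r)%N by lia.
rewrite rE /= ifT; last by lia.
(* The neighbour towards the centre may lie past the middle, where symmetry folds it back. *)
suff -> : s r.+2 = s (N - (if j is 0 then 1 else j.-2))./2 by ring.
have [|] := leqP 2 j.
  by move=> j2; congr s; case: j jN rE j2 => [|[|j]] /=; lia.
case: j jN rE => [|[|//]] jN rE _ /=.
  by rewrite -(s_sym (r := r.+2)); [congr s|]; lia.
have [N2|N2] := boolP (odd N); last by congr s; lia.
by rewrite -(s_sym (r := r.+2)); [congr s|]; lia.
Qed.

(** This is [path_eigen_quad] with vertices and edges reordered; the weights of both are symmetric,
    so [sum_half] applies to each. *)
Lemma zigzag_quad :
  K * \sum_(j < N.+1) zigzag j ^+ 2 = \sum_(i < N) edge_form (zigzag i.+1) (zigzag i.-1).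
Proof.
have rev n (F : nat -> R) : \sum_(j < n) F j = \sum_(j < n) F (n.-1 - j)%N.
  rewrite (reindex_inj rev_ord_inj) /=; apply: eq_bigr => j _.
  by congr F; have := ltn_ord j; lia.
have -> : \sum_(j < N.+1) zigzag j ^+ 2 = \sum_(r < N.+1) s r ^+ 2.
  rewrite (rev _ (fun j => zigzag j ^+ 2)) -(sum_half (h := fun r => s r ^+ 2)) => [|r rN]; last first.
    by rewrite /= s_sym //; lia.
  apply: eq_bigr => j _; rewrite /zigzag; congr (s _ ^+ 2).
  by have := ltn_ord j; lia.
rewrite path_eigen_quad -(sum_half (h := fun r => edge_form (s r) (s r.+1))).
  rewrite [RHS](rev N (fun i => edge_form (zigzag i.+1) (zigzag i.-1))).
  apply: eq_bigr => -[j jN] _ /=; rewrite /zigzag.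
  have -> : ((N - (N.-1 - j).+1)./2 = j./2)%N by lia.
  (* The case [j = N.-1] is the edge between indices 1 and 0, where [.-1] truncates. *)
  have [jN2|jN2] := eqVneq j N.-1; last by congr (edge_form _ (s _)); lia.
  rewrite jN2 subnn /= subn0; have [N2|N2] := boolP (odd N); last first.
    by congr (edge_form _ (s _)); lia.
  congr edge_form; rewrite -(s_sym (r := N./2)); last by lia.
  by congr s; lia.
move=> r rN; rewrite (_ : (N.-1 - r).+1 = (N - r)%N); last by lia.
rewrite (_ : (N.-1 - r)%N = (N - r.+1)%N); last by lia.
by rewrite !s_sym; [rewrite /edge_form; ring|lia|lia].
Qed.
End PathWeights.

(** * The clique path in block coordinates and its block sums *)

Lemma clique_path_sym k N : symmetric (clique_path k N).
Proof.
move=> u v; rewrite /clique_path eq_sym [v == u]eq_sym; congr (_ || _).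
exact: orbC.
Qed.

Lemma clique_path_irr k N : irreflexive (clique_path k N).
Proof.
move=> u; rewrite /clique_path !eqxx /= orbb /cp_link.
by rewrite (ltn_eqF (ltnSn _)).
Qed.

Section CliquePathBlocks.
Variables (k N : nat).
Lemma block_ltn i r : (i <= N)%N -> (r < k)%N -> (i * k + r < k * N.+1)%N.
Proof. by move=> iN rk; nia. Qed.

Definition block_vertex i r (iN : (i <= N)%N) (rk : (r < k)%N) : 'I_(k * N.+1) :=
  Ordinal (block_ltn iN rk).

Lemma block_divn i r : (r < k)%N -> ((i * k + r) %/ k)%N = i.
Proof. by move=> rk; rewrite divnMDl ?divn_small ?addn0 //; lia. Qed.

Lemma block_modn i r : (r < k)%N -> ((i * k + r) %% k)%N = r.
Proof. by move=> rk; rewrite modnMDl modn_small. Qed.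

Lemma block_vertex_eq i r (iN : (i <= N)%N) (rk : (r < k)%N)
    j q (jN : (j <= N)%N) (qk : (q < k)%N) :
  (block_vertex iN rk == block_vertex jN qk) = (i == j) && (r == q).
Proof.
rewrite -val_eqE /=; apply/eqP/andP=> [E|[/eqP-> /eqP->] //].
by rewrite -(block_divn i rk) -{2}(block_modn i rk) E block_divn ?block_modn ?eqxx.
Qed.

Lemma clique_path_blockE i r (iN : (i <= N)%N) (rk : (r < k)%N)
    j q (jN : (j <= N)%N) (qk : (q < k)%N) :
  clique_path k N.+1 (block_vertex iN rk) (block_vertex jN qk) =
  [|| (i == j) && (r != q), [&& j == i.+1, r == 1%N & q == 0%N]
    | [&& i == j.+1, q == 1%N & r == 0%N]].
Proof.
rewrite /clique_path /cp_link /= !block_divn // !block_modn //.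
congr (_ || _); case: eqVneq => //= ij.
by rewrite -val_eqE /= ij eqn_add2l.
Qed.

Hypothesis k_gt1 : (1 < k)%N.

Lemma clique_path_vertexP (u : 'I_(k * N.+1)) :
  exists i r (iN : (i <= N)%N) (rk : (r < k)%N), u = block_vertex iN rk.
Proof.
have iN : (u %/ k <= N)%N.
  by rewrite -ltnS ltn_divLR ?(ltnW k_gt1) // [X in (_ < X)%N]mulnC ltn_ord.
have rk : (u %% k < k)%N by rewrite ltn_pmod // ltnW.
by exists (u %/ k)%N, (u %% k)%N, iN, rk; apply: val_inj; rewrite /= -divn_eq.
Qed.

Variables (R : realFieldType) (l : R).

(** Adding the entry itself to its neighbour sum completes the block, so [t] times an entry is the
    block sum plus the entry across a link. The two ends of a link then solve a linear system with
    determinant [t ^+ 2 - 1], which eliminates all single entries. *)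
Lemma clique_path_weights :
  rayleigh_max (clique_path k N.+1) l ->
  exists s : nat -> R, [/\ path_eigen (l + 1) N (((l + 1) ^+ 2 - 1) * (l + 1 - k%:R)) s,
    forall r, (r <= N)%N -> 0 <= s r, exists2 r, (r <= N)%N & 0 < s r
    & forall r, (r <= N)%N -> s (N - r)%N = s r].
Proof.
move=> [_ [x [x_ge0 [u0 xu0] xE]]].
(* Extending the vector by 0 to all naturals allows index arithmetic without bounds. *)
pose y v := if insub v is Some u then x u else 0.
have yE (u : 'I_(k * N.+1)) : y u = x u by rewrite /y valK.
have y_ge0 v : 0 <= y v by rewrite /y; case: insub.
pose S i := \sum_(r < k) y (i * k + r)%N.
pose t := l + 1.
have k_gt0 : (0 < k)%N by apply: ltnW.
have blockE i r : (i <= N)%N -> (r < k)%N -> t * y (i * k + r)%N = S i +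
    ((if (i < N)%N && (r == 1%N) then y (i.+1 * k)%N else 0) +
     (if (0 < i)%N && (r == 0%N) then y (i.-1 * k + 1)%N else 0)).
  move=> iN rk; pose v := block_vertex iN rk.
  have -> : t * y (i * k + r)%N = x v + \sum_(u | clique_path k N.+1 v u) x u.
    by rewrite xE -yE /= /t mulrDl mul1r addrC.
  have SE : S i = x v + \sum_(u : 'I_(k * N.+1) | (u %/ k == i)%N && (u != v)) x u.
    rewrite -(bigD1 v) /=; last by rewrite block_divn.
    pose h (q : 'I_k) := block_vertex iN (ltn_ord q).
    pose h' (u : 'I_(k * N.+1)) := Ordinal (ltn_pmod u k_gt0).
    rewrite (reindex_onto h h') => [|u /eqP ui]; last first.
      by apply: val_inj; rewrite /= -ui -divn_eq.
    rewrite [RHS]big_mkcond; apply: eq_bigr => q _.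
    rewrite block_divn // eqxx -(yE (h q)) /= ifT //.
    by apply/eqP/val_inj; rewrite /= block_modn.
  rewrite SE -addrA; congr (_ + _).
  rewrite (bigID (fun u : 'I_(k * N.+1) => u %/ k == i)%N) /=; congr (_ + _).
    apply: eq_bigl => u; have [j [q [jN [qk ->]]]] := clique_path_vertexP u.
    by rewrite clique_path_blockE block_vertex_eq block_divn //; lia.
  rewrite (bigID (fun u : 'I_(k * N.+1) => u %/ k == i.+1)%N) /=; congr (_ + _).
    case: ifP => [/andP[iN1 /eqP r1]|nc].
      rewrite (big_pred1 (block_vertex iN1 k_gt0)) => [|u]; first by rewrite -yE /= addn0.
      have [j [q [jN [qk ->]]]] := clique_path_vertexP u.
      by rewrite clique_path_blockE /= block_vertex_eq block_divn //; lia.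
    rewrite big_pred0 // => u; have [j [q [jN [qk ->]]]] := clique_path_vertexP u.
    by rewrite clique_path_blockE block_divn //; lia.
  case: ifP => [/andP[i0 /eqP r0]|nc].
    have iN1 : (i.-1 <= N)%N by lia.
    rewrite (big_pred1 (block_vertex iN1 k_gt1)) => [|u]; first by rewrite -yE.
    have [j [q [jN [qk ->]]]] := clique_path_vertexP u.
    by rewrite clique_path_blockE /= block_vertex_eq block_divn //; lia.
  rewrite big_pred0 // => u; have [j [q [jN [qk ->]]]] := clique_path_vertexP u.
  by rewrite clique_path_blockE block_divn //; lia.
have linkE i : (i < N)%N ->
    ((t ^+ 2 - 1) * y (i.+1 * k)%N = S i + t * S i.+1) *
    ((t ^+ 2 - 1) * y (i * k + 1)%N = S i.+1 + t * S i).
  move=> iN; have := blockE i.+1 0%N iN k_gt0; have := blockE i 1%N (ltnW iN) k_gt1.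
  rewrite iN eqxx addn0 /= !andbF /= add0r addr0 => E1 E2.
  have {}E1 : S i = t * y (i * k + 1)%N - y (i.+1 * k)%N by rewrite E1 addrK.
  have {}E2 : S i.+1 = t * y (i.+1 * k)%N - y (i * k + 1)%N by rewrite E2 addrK.
  by split; rewrite E1 E2; ring.
have sum_pick r0 c : (r0 < k)%N -> \sum_(r < k) (if (r == r0 :> nat) then c else 0 : R) = c.
  by move=> r0k; rewrite -big_mkcond; apply: (big_pred1 (Ordinal r0k)).
have S_eigen : path_eigen t N ((t ^+ 2 - 1) * (t - k%:R)) S.
  move=> i iN.
  (* Sum of [blockE] over the [k] vertices of the block. *)
  have tS : (t - k%:R) * S i = (if (i < N)%N then y (i.+1 * k)%N else 0) +
      (if (0 < i)%N then y (i.-1 * k + 1)%N else 0).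
    apply: (addIr (k%:R * S i)); rewrite mulrBl subrK {1}/S mulr_sumr.
    under eq_bigr => r _ do rewrite blockE //.
    rewrite big_split sumr_const card_ord mulr_natl [RHS]addrC; congr (_ + _).
    rewrite big_split; congr (_ + _).
      by case: ifP => _ /=; [rewrite sum_pick | rewrite big1].
    by case: ifP => _ /=; [rewrite sum_pick | rewrite big1].
  rewrite -mulrA tS mulrDr; congr (_ + _).
    by case: ifP => [iN1|_]; rewrite ?mulr0 // linkE.
  case: ifP => [i0|_]; rewrite ?mulr0 //.
  by case: i i0 iN {tS} => // i _ iN; rewrite linkE.
have S_ge0 i : 0 <= S i by apply: sumr_ge0.
rewrite -/t; set K := (t ^+ 2 - 1) * _ in S_eigen *.
(* The equation is linear and invariant under reversal of the path, so adding the mirror image makes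
   the solution symmetric. *)
exists (fun r => S r + S (N - r)%N); split=> [r rN|r _||r rN].
- have := S_eigen r rN; have := S_eigen (N - r)%N (leq_subr _ _).
  rewrite [K * (S r + _)]mulrDr => -> ->.
  have [r0|r0] := posnP r; have [rN0|rN0] := ltnP r N.
  + rewrite r0 subn0 ltnn /= (_ : (0 < N)%N); last by lia.
    by rewrite (_ : (N - 1)%N = N.-1); [ring|lia].
  + have -> : r = N by lia.
    by rewrite r0 in rN0 *; rewrite (_ : N = 0%N); [rewrite /=; ring|lia].
  + rewrite (_ : (N - r < N)%N); last by lia.
    rewrite (_ : (0 < N - r)%N); last by lia.
    rewrite (_ : (N - r).-1 = (N - r.+1)%N); last by lia.
    by rewrite (_ : (N - r).+1 = (N - r.-1)%N); [ring|lia].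
  + have -> : r = N by lia.
    rewrite subnn /= (_ : (0 < N)%N); last by lia.
    by rewrite (_ : (N - N.-1)%N = 1%N); [ring|lia].
- by rewrite addr_ge0.
- have [i [r [iN [rk u0E]]]] := clique_path_vertexP u0; exists i => //.
  rewrite ltr_wpDr // /S (bigD1 (Ordinal rk)) //= ltr_wpDr ?sumr_ge0 //.
  by move: xu0; rewrite -yE u0E.
- by rewrite subKn // addrC.
Qed.
End CliquePathBlocks.

(** * Comparison with the clique path *)

Section Comparison.
Variables (R : realFieldType) (n N k : nat) (e : rel 'I_n) (c : 'I_n -> nat).
Hypotheses (e_sym : symmetric e) (e_irr : irreflexive e).
Hypothesis c_lt : forall u, (c u < N.+1)%N.
Hypothesis c_clique : forall u v, c u = c v -> u != v -> e u v.
Hypothesis c_card : forall i, (i < N.+1)%N -> #|[set u | c u == i]| = k.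
Hypothesis k_gt0 : (0 < k)%N.
Hypothesis c_parent : forall i, (0 < i < N.+1)%N ->
  exists u v, [/\ c u = i, e u v & (c v <= i.-2)%N].

Variables (t : R) (z : nat -> R).
Hypothesis t_gt1 : 1 < t.
Hypothesis z_gt0 : forall i, 0 < z i.
Hypothesis z_decr : forall i j, (i <= j)%N -> z j <= z i.

Let K := (t ^+ 2 - 1) * (t - k%:R).
Hypothesis z_quad : K * \sum_(j < N.+1) z j ^+ 2 =
  \sum_(i < N) edge_form t (z i.+1) (z i.-1).

Definition crossing : rel 'I_n := fun u v => e u v && (c u != c v).

Let t_gt0 : 0 < t. Proof. by apply: lt_trans t_gt1. Qed.
Let t2_gt0 : 0 < t ^+ 2 - 1.
Proof. by rewrite subr_gt0 exprn_egt1 // ltW. Qed.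

(** [t * link_weight u v] is the value of the test vector at [v] when [u] is the only vertex joined
    to [v] by a crossing edge. *)
Definition link_weight u v := z (c u) + t * z (c v).

Let link_gt0 u v : 0 < link_weight u v.
Proof. by rewrite addr_gt0 ?mulr_gt0. Qed.

(* The test vector: the Perron vector of the clique path, with the excess carried
   by each end of a linking edge placed on whatever vertex the edge is attached to. *)
Definition test_vector u :=
  (t ^+ 2 - 1) * z (c u) + \sum_(v | crossing u v) link_weight u v.

Let Y := test_vector.
Let S i := \sum_(u | c u == i) Y u.
(** [D] turns out to be the defect in the eigenvalue equation of block [i]; [G u v] is the part of
    [Y v] due to crossing edges at [v] other than the one to [u]. *)
Let D i := S i - t * (t ^+ 2 - 1) * z i.
Let G u v := Y v - t * link_weight u v.

Let crossing_sym : symmetric crossing.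
Proof. by move=> u v; rewrite /crossing e_sym eq_sym. Qed.

Lemma test_vector_gt0 u : 0 < Y u.
Proof.
by rewrite ltr_pwDl ?mulr_gt0 // sumr_ge0 // => v _; rewrite ltW.
Qed.

Lemma test_vector_excess u v : crossing u v ->
  G u v = \sum_(w | crossing v w && (w != u)) link_weight v w.
Proof.
rewrite crossing_sym => vu; rewrite /G /Y /test_vector (bigD1 u) //= /link_weight.
by ring.
Qed.

Lemma excess_ge0 u v : crossing u v -> 0 <= G u v.
Proof. by move=> uv; rewrite test_vector_excess // sumr_ge0 // => w _; rewrite ltW. Qed.

(** The terms in [D] and [G] are all that keeps [Y] from being an eigenvector for [t - 1]. *)
Lemma adjacency_test_vector u :
  \sum_(v | e u v) Y v = (t - 1) * Y u + D (c u) + \sum_(v | crossing u v) G u v.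
Proof.
have -> : \sum_(v | e u v) Y v = S (c u) - Y u + \sum_(v | crossing u v) Y v.
  rewrite (bigID (fun v => c u == c v)) /=; congr (_ + _).
  rewrite /S [in RHS](bigD1 u) //= addrAC subrr add0r; apply: eq_bigl => v.
  rewrite eq_sym; case: (eqVneq (c v) (c u)) => [cvu|_]; last by rewrite andbF.
  by rewrite andbT; case: (eqVneq v u) => [->|vu]; rewrite ?e_irr // c_clique // eq_sym.
rewrite /D /G sumrB -mulr_sumr.
have -> : \sum_(v | crossing u v) link_weight u v = Y u - (t ^+ 2 - 1) * z (c u).
  by rewrite /Y /test_vector addrC addKr.
by ring.
Qed.

Definition link_sum i :=
  \sum_(p : 'I_n * 'I_n | (c p.1 == i) && crossing p.1 p.2) link_weight p.1 p.2.

(** Each crossing edge is charged to its higher-numbered block, hence counted once in total. *)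
Definition down_sum i :=
  \sum_(p : 'I_n * 'I_n | (c p.1 == i) && (e p.1 p.2 && (c p.2 < c p.1)%N))
     edge_form t (z (c p.1)) (z (c p.2)).

Lemma defectE i : (i < N.+1)%N -> D i = link_sum i - K * z i.
Proof.
move=> iN; rewrite /D /S /Y /test_vector big_split /=.
have -> : \sum_(u | c u == i) (t ^+ 2 - 1) * z (c u) = k%:R * ((t ^+ 2 - 1) * z i).
  rewrite (eq_bigr (fun=> (t ^+ 2 - 1) * z i)) => [|u /eqP->] //.
  rewrite sumr_const mulr_natl -(c_card iN); congr (_ *+ _).
  by apply: eq_card => u; rewrite inE.
rewrite /link_sum pair_big_dep /= /K; ring.
Qed.

Lemma sum_by_block (F : 'I_n -> R) :
  \sum_u F u = \sum_(i < N.+1) \sum_(u | c u == i) F u.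
Proof.
by rewrite (partition_big (fun u => Ordinal (c_lt u)) predT).
Qed.

(** The two orientations of a crossing edge together contribute one [edge_form]. *)
Lemma sum_link_sum :
  \sum_(i < N.+1) z i * link_sum i = \sum_(i < N.+1) down_sum i.
Proof.
have sumP (P : rel 'I_n) (F : 'I_n -> 'I_n -> R) :
    \sum_(i < N.+1) \sum_(p : 'I_n * 'I_n | (c p.1 == i) && P p.1 p.2) F p.1 p.2 =
    \sum_u \sum_(v | P u v) F u v.
  by rewrite sum_by_block; apply: eq_bigr => i _; rewrite pair_big_dep.
rewrite /down_sum (sumP (fun u v => e u v && (c v < c u)%N)
   (fun u v => edge_form t (z (c u)) (z (c v)))).
transitivity (\sum_u \sum_(v | crossing u v) z (c u) * link_weight u v).
  rewrite -(sumP crossing); apply: eq_bigr => i _; rewrite mulr_sumr.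
  by apply: eq_bigr => p /andP[/eqP-> _].
transitivity (\sum_u (\sum_(v | e u v && (c v < c u)%N) z (c u) * link_weight u v +
                      \sum_(v | e u v && (c u < c v)%N) z (c u) * link_weight u v)).
  apply: eq_bigr => u _; rewrite (bigID (fun v => c v < c u)%N) /=; congr (_ + _).
    by apply: eq_bigl => v; rewrite /crossing; case: (e u v) => //=; lia.
  by apply: eq_bigl => v; rewrite /crossing; case: (e u v) => //=; lia.
rewrite big_split /= [X in _ + X](exchange_big_dep predT) //= -big_split /=.
apply: eq_bigr => u _.
rewrite [X in _ + X](eq_bigl (fun v => e u v && (c v < c u)%N)) => [|v]; last by rewrite e_sym.
by rewrite -big_split /=; apply: eq_bigr => v _; rewrite /edge_form /link_weight; ring.
Qed.

Lemma down_sum0 : down_sum 0 = 0.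
Proof. by rewrite /down_sum big_pred0 // => p; lia. Qed.

Lemma edge_form_gt0 i j : 0 < edge_form t (z i) (z j).
Proof.
have tz : 0 < t * z i * z j by rewrite !mulr_gt0.
by rewrite /edge_form !addr_gt0 ?exprn_gt0 ?mulr2n ?addr_gt0.
Qed.

Lemma edge_form_decr i j j' : (j <= j')%N ->
  edge_form t (z i) (z j') <= edge_form t (z i) (z j).
Proof.
move=> /z_decr jj; have := z_gt0 j'; have := z_gt0 i => zi zj.
rewrite /edge_form lerD ?lerD2l ?lerMn2r ?ler_pM2l ?mulr_gt0 //.
by rewrite ler_pXn2r // nnegrE ltW // (lt_le_trans zj).
Qed.

(** The edge given by [c_parent] suffices: it ends in a block numbered at most [i.-1], whose weight
    is at least [z i.-1]. *)
Lemma down_sum_ge i : (i < N)%N -> edge_form t (z i.+1) (z i.-1) <= down_sum i.+1.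
Proof.
move=> iN; have [u [v [ui uv vi]]] := c_parent (i := i.+1) iN.
rewrite /down_sum (bigD1 (u, v)) /=; last by rewrite ui eqxx uv /=; lia.
rewrite ui; apply: le_trans (edge_form_decr _ vi) _.
by rewrite lerDl sumr_ge0 // => p _; rewrite ltW // edge_form_gt0.
Qed.

(** Substituting [S i = D i + t * (t ^+ 2 - 1) * z i] leaves a term linear in [D], which [z_quad]
    identifies with the surplus of crossing edges over the path. All three terms are nonnegative. *)
Lemma test_vector_quad :
  \sum_u Y u * \sum_(v | e u v) Y v - (t - 1) * \sum_u Y u ^+ 2 =
  \sum_u Y u * (\sum_(v | crossing u v) G u v) + \sum_(i < N.+1) D i ^+ 2 +
  t * (t ^+ 2 - 1) * \sum_(i < N) (down_sum i.+1 - edge_form t (z i.+1) (z i.-1)).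
Proof.
have -> : \sum_(i < N) (down_sum i.+1 - edge_form t (z i.+1) (z i.-1)) =
    \sum_(i < N.+1) z i * D i.
  rewrite sumrB -z_quad; have -> : \sum_(i < N) down_sum i.+1 = \sum_(i < N.+1) down_sum i.
    by rewrite [RHS]big_ord_recl down_sum0 add0r.
  rewrite -sum_link_sum mulr_sumr -sumrB; apply: eq_bigr => i _.
  by rewrite defectE //; ring.
have -> : \sum_(i < N.+1) D i ^+ 2 =
    \sum_(i < N.+1) S i * D i - t * (t ^+ 2 - 1) * \sum_(i < N.+1) z i * D i.
  by rewrite mulr_sumr -sumrB; apply: eq_bigr => i _; rewrite /D; ring.
rewrite -addrA subrK mulr_sumr -sumrB.
have -> : \sum_(i < N.+1) S i * D i = \sum_u Y u * D (c u).
  rewrite sum_by_block; apply: eq_bigr => i _; rewrite mulr_suml.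
  by apply: eq_bigr => u /eqP->.
by rewrite -big_split; apply: eq_bigr => u _; rewrite adjacency_test_vector /=; ring.
Qed.

Variable l : R.
Hypothesis l_max : rayleigh_max e l.

Let excess_sum_ge0 u : 0 <= Y u * (\sum_(v | crossing u v) G u v).
Proof.
by rewrite mulr_ge0 ?(ltW (test_vector_gt0 u)) ?sumr_ge0 // => v; apply: excess_ge0.
Qed.

Let gap_ge0 i : (i < N)%N -> 0 <= down_sum i.+1 - edge_form t (z i.+1) (z i.-1).
Proof. by move=> iN; rewrite subr_ge0 down_sum_ge. Qed.

Lemma comparison : t - 1 <= l.
Proof.
have [u0 _] : exists u, u \in [set u | c u == 0%N].
  by apply/set0Pn; rewrite -card_gt0 c_card.
have Y2 := sum_sqr_gt0 (test_vector_gt0 u0).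
have [le _] := l_max; rewrite -(ler_pM2r Y2).
apply: le_trans (le Y); rewrite -subr_ge0 test_vector_quad.
rewrite !addr_ge0 ?sumr_ge0 // => [u _|]; first exact: sqr_ge0.
by rewrite mulr_ge0 ?sumr_ge0 ?mulr_ge0 ?(ltW t_gt0) ?(ltW t2_gt0) // => i _; apply: gap_ge0.
Qed.

Hypothesis l_le : l <= t - 1.

(** The Rayleigh gap is now at most 0, so each of its three nonnegative parts vanishes term by
    term. *)
Lemma comparison_tight :
  [/\ forall u v, crossing u v -> G u v = 0, forall i, (i < N.+1)%N -> link_sum i = K * z i
    & forall i, (i < N)%N -> down_sum i.+1 = edge_form t (z i.+1) (z i.-1)].
Proof.
have A0 : 0 <= \sum_u Y u * (\sum_(v | crossing u v) G u v) by apply: sumr_ge0.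
have B0 : 0 <= \sum_(i < N.+1) D i ^+ 2 by apply: sumr_ge0 => i _; apply: sqr_ge0.
have C0 : 0 <= \sum_(i < N) (down_sum i.+1 - edge_form t (z i.+1) (z i.-1)).
  by apply: sumr_ge0 => i _; apply: gap_ge0.
have T0 : 0 < t * (t ^+ 2 - 1) by apply: mulr_gt0.
have TC0 := mulr_ge0 (ltW T0) C0.
have : \sum_u Y u * (\sum_(v | e u v) Y v) - (t - 1) * \sum_u Y u ^+ 2 <= 0.
  have [le _] := l_max; rewrite subr_le0 (le_trans (le Y)) // ler_wpM2r //.
  by apply: sumr_ge0 => u _; apply: sqr_ge0.
rewrite test_vector_quad => le0.
have {A0} AE : \sum_u Y u * (\sum_(v | crossing u v) G u v) = 0 by lra.
have {B0} BE : \sum_(i < N.+1) D i ^+ 2 = 0 by lra.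
have {TC0}/eqP : t * (t ^+ 2 - 1) *
   \sum_(i < N) (down_sum i.+1 - edge_form t (z i.+1) (z i.-1)) = 0 by lra.
rewrite mulf_eq0 (gt_eqF T0) /= => /eqP CE; split=> [u v uv|i iN|i iN].
- have := psumr_eq0P (fun u _ => excess_sum_ge0 u) AE.
  move=> /(_ u isT)/eqP; rewrite mulf_eq0 (gt_eqF (test_vector_gt0 u)) /= => /eqP GE.
  exact: (psumr_eq0P (fun v uv => excess_ge0 uv) GE).
- have := psumr_eq0P (fun (i : 'I_N.+1) _ => sqr_ge0 (D i)) BE.
  by move=> /(_ (Ordinal iN) isT)/eqP; rewrite sqrf_eq0 defectE // subr_eq0 => /eqP.
- have := psumr_eq0P (fun (i : 'I_N) _ => gap_ge0 (ltn_ord i)) CE.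
  by move=> /(_ (Ordinal iN) isT)/eqP; rewrite subr_eq0 => /eqP.
Qed.

(** A second crossing edge at [u] would make [G v u] positive. *)
Lemma tight_matching u v w : crossing u v -> crossing u w -> v = w.
Proof.
move=> uv uw; apply/eqP; apply: contraT => vw.
have [/(_ v u) GE _ _] := comparison_tight; have := GE; rewrite crossing_sym => /(_ uv).
rewrite test_vector_excess; last by rewrite crossing_sym.
rewrite (bigD1 w) /=; last by rewrite uw eq_sym.
move/eqP; rewrite gt_eqF // ltr_pwDl // sumr_ge0 // => ? _; exact: ltW.
Qed.

(** The edge from [c_parent] already fills the exact value of [down_sum]; a second downward edge
    would exceed it. *)
Lemma tight_down_unique u v u' v' :
  e u v -> (c v < c u)%N -> e u' v' -> (c v' < c u')%N -> c u = c u' -> u = u' /\ v = v'.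
Proof.
move=> uv vu uv' vu' cu.
have [_ _ downE] := comparison_tight.
have iN := c_lt u; move: (iN); case ciE : (c u) (leq_ltn_trans (leq0n _) vu) => [//|i] _ iN'.
have [x [y [xi xy yi]]] := c_parent (i := i.+1) iN'.
suff uniq a b : e a b -> (c b < c a)%N -> c a = i.+1 -> (a, b) = (x, y).
  have [] := uniq u v uv vu ciE; have [] := uniq u' v' uv' vu' (etrans (esym cu) ciE).
  by move=> <- <- -> ->.
move=> ab ba ai; apply/eqP; apply: contraT => ne.
have := downE i iN'; rewrite /down_sum (bigD1 (x, y)) /=; last first.
  by rewrite xi eqxx xy /=; lia.
rewrite (bigD1 (a, b)) /=; last by rewrite ai eqxx ab ne andbT -ai.
rewrite xi ai; have := edge_form_decr i.+1 yi; have := edge_form_gt0 i.+1 (c b).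
set rest := \sum_(_ | _) _; have rest_ge0 : 0 <= rest.
  by apply: sumr_ge0 => p _; rewrite ltW // edge_form_gt0.
by move=> /= h1 h2 /eqP; rewrite gt_eqF // (le_lt_trans h2) // ltrDl ltr_wpDr.
Qed.

Hypothesis z_eigen : forall j, (j.+2 <= N)%N ->
  K * z j = 2 * z j + t * z j.+2 + t * z (if j is 0 then 1 else j.-2)%N.

(* If block [i] hangs below block [j < i - 2], then [j] has one neighbour more than
   in the path, which violates the eigenvalue equation at [j]. *)
Lemma tight_parent i : (0 < i < N.+1)%N -> exists u v, [/\ c u = i, e u v & c v = i.-2].
Proof.
elim/ltn_ind: i => i IH iN; have [u [v [ui uv vi]]] := c_parent iN.
exists u, v; split=> //; apply/eqP; move: vi; rewrite leq_eqVlt => /predU1P[->//|vi].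
set j := c v in vi *.
have jN : (j.+2 < N.+1)%N by lia.
have [||x [y [xj xy yj]]] := IH j.+2; [lia|lia|rewrite /= in yj].
have [p [q [pj pq]]] : exists p q, [/\ c p = j, crossing p q &
    c q = if j is 0 then 1%N else j.-2].
  case jE : j => [|j'].
    have [||p [q [p1 pq q0]]] := IH 1%N; [lia|lia|exists q, p].
    by rewrite /crossing e_sym pq q0 p1.
  have [||p [q [p1 pq q0]]] := IH j; [lia|lia|exists p, q].
  by rewrite /crossing pq p1 q0 jE; split=> //=; lia.
move=> qE; have [_ linkE _] := comparison_tight.
have := linkE j (c_lt v); rewrite z_eigen // -qE /link_sum.
have vu : crossing v u by rewrite /crossing e_sym uv ui -/j; lia.
have yx : crossing y x by rewrite /crossing e_sym xy xj yj; lia.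
have cq : (c q < j.+2)%N by rewrite qE; case: (j) => //= ?; lia.
(* Three links at block [j]: to [i], to [j + 2] and to [j - 2] (to 1 when [j = 0]). They exceed the
   right-hand side by [z j + t * z i]. *)
rewrite (bigD1 (v, u)) /=; last by rewrite eqxx.
rewrite (bigD1 (y, x)) /=; last first.
  by rewrite yj eqxx yx /=; apply/eqP=> -[_ xu]; move: ui; rewrite -xu xj; lia.
rewrite (bigD1 (p, q)) /=; last first.
  rewrite pj eqxx pq /=; apply/andP; split; apply/eqP=> -[_ qx].
    by move: cq; rewrite qx ui; lia.
  by move: cq; rewrite qx xj ltnn.
set rest := \sum_(_ | _) _; have rest_ge0 : 0 <= rest by apply: sumr_ge0 => ? _; apply: ltW.
rewrite /link_weight -/j ui yj xj pj => E.
have := z_gt0 j; have := mulr_gt0 t_gt0 (z_gt0 i); lra.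
Qed.
End Comparison.

(** * Recognising the clique path up to isomorphism *)

Section CliquePathRecognition.
Variables (k N : nat) (e : rel 'I_(k * N.+1)) (p : 'I_(k * N.+1) -> nat).
Hypotheses (k_gt1 : (1 < k)%N) (e_sym : symmetric e) (e_irr : irreflexive e).
Hypothesis p_le : forall u, (p u <= N)%N.
Hypothesis p_clique : forall u v, p u = p v -> u != v -> e u v.
Hypothesis p_card : forall r, (r <= N)%N -> #|[set u | p u == r]| = k.
Hypothesis matching : forall u v w, e u v -> p u != p v -> e u w -> p u != p w -> v = w.
Hypothesis adjacent_blocks : forall u v, e u v -> p u != p v ->
  p v = (p u).+1 \/ p u = (p v).+1.
Hypothesis linked : forall r, (r < N)%N -> exists u v, [/\ p u = r, p v = r.+1 & e u v].
Hypothesis link_unique : forall u v u' v',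
  e u v -> p v = (p u).+1 -> e u' v' -> p v' = (p u').+1 -> p u = p u' -> u = u' /\ v = v'.

(** Lists block [r] with its end of the link from below at position 0 and of the link upwards at
    position 1, as in [cp_link]. The matching hypothesis keeps the two ends distinct; a missing end
    is replaced by any other vertex of the block. *)
Lemma block_port_order r : (r <= N)%N -> exists s : seq 'I_(k * N.+1),
  [/\ size s = k, forall u, (u \in s) = (p u == r),
   forall u v, p u = r -> e u v -> p v = r.+1 -> index u s = 1%N &
   forall u v, p u = r -> e u v -> (p v).+1 = r -> index u s = 0%N].
Proof.
move=> rN.
have other w : exists2 w', p w' = r & w' != w.
  have : (1 < #|[set u | p u == r]|)%N by rewrite p_card.
  case/card_gt1P=> a [b [ar br ab]]; rewrite !inE in ar br.
  have [aw|aw] := eqVneq a w; last by exists a => //; apply/eqP.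
  by exists b; [apply/eqP | rewrite -aw eq_sym].
have [x [y [xr yr xy yP xP]]] : exists x y, [/\ p x = r, p y = r, x != y,
    forall u v, p u = r -> e u v -> p v = r.+1 -> u = y &
    forall u v, p u = r -> e u v -> (p v).+1 = r -> u = x].
  have up : (r < N)%N -> exists y v, [/\ p y = r, p v = r.+1, e y v &
      forall u v, p u = r -> e u v -> p v = r.+1 -> u = y].
    move=> /linked[y [v [yr vr yv]]]; exists y, v; split=> // u v' ur uv' vr'.
    have [] := @link_unique u v' y v uv' _ yv _ _; rewrite ?ur ?yr ?vr ?vr' //.
  have down : (0 < r)%N -> exists x w, [/\ p x = r, (p w).+1 = r, e x w &
      forall u v, p u = r -> e u v -> (p v).+1 = r -> u = x].
    move=> r0; have [|w [x [wr xr wx]]] := linked (r := r.-1); first by lia.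
    rewrite prednK // in xr; exists x, w; rewrite e_sym; split=> //; first by lia.
    move=> u v ur uv vr; rewrite e_sym in uv.
    by have [] := @link_unique v u w x uv _ wx _ _; [lia|lia|lia|].
  have [/up[y [v [yr vr yv yP]]]|Nr] := ltnP r N; have [r0|/down[x [w [xr wr xw xP]]]] := posnP r.
  - have [x xr xy] := other y; exists x, y; split=> // u v' _ _.
    by rewrite r0.
  - exists x, y; split=> //; apply: contraT; rewrite negbK => /eqP xy.
    have yw : e y w by rewrite -xy.
    have vw : v = w by apply: (matching yv _ yw); lia.
    by rewrite vw in vr; lia.
  (* For a single block any two vertices serve; the vertex passed to [other] is arbitrary. *)
  - have [x xr _] := other (block_vertex (leq0n N) k_gt1).
    have [y yr yx] := other x; exists x, y; rewrite eq_sym; split=> // u v _ _ vr.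
      by have := p_le v; lia.
    by move: vr; rewrite r0.
  - have [y yr yx] := other x; exists x, y; rewrite eq_sym; split=> // u v _ _ vr.
    by have := p_le v; lia.
pose s := x :: y :: [seq w <- enum 'I_(k * N.+1) | [&& p w == r, w != x & w != y]].
have s_mem u : (u \in s) = (p u == r).
  rewrite !inE mem_filter mem_enum andbT.
  case: eqVneq => [->|ux]; first by rewrite xr eqxx.
  by case: eqVneq => [->|uy] /=; rewrite ?yr ?eqxx ?andbT.
have s_uniq : uniq s.
  rewrite /= inE !mem_filter !eqxx /= !andbF orbF xy filter_uniq ?enum_uniq //.
exists s; split=> //.
- rewrite -[RHS](p_card rN) -(card_uniqP s_uniq); apply: eq_card => u.
  by rewrite s_mem inE.
- by move=> u v ur uv vr; rewrite (yP u v) //= (negPf xy) eqxx.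
- by move=> u v ur uv vr; rewrite (xP u v) //= eqxx.
Qed.

Lemma clique_path_recognition : graph_iso e (clique_path k N.+1).
Proof.
have [s sP] := fin_all_exists (fun r : 'I_N.+1 => block_port_order (ltn_ord r : (r <= N)%N)).
pose B u : 'I_N.+1 := inord (p u).
have BE u : B u = p u :> nat by rewrite inordK ?ltnS.
pose g u := index u (s (B u)).
have us u : u \in s (B u) by have [_ -> _ _] := sP (B u); rewrite BE.
have g_lt u : (g u < k)%N.
  have [sk _ _ _] := sP (B u); have : (g u < size (s (B u)))%N by rewrite index_mem.
  by rewrite [X in (_ < X)%N]sk.
pose f u := block_vertex (p_le u) (g_lt u).
have g_inj u v : p u = p v -> g u = g v -> u = v.
  move=> puv; rewrite /g /B -puv -/(B u) => guv.
  by rewrite -(nth_index u (us u)) guv nth_index // /B puv us.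
have g_up u v : e u v -> p v = (p u).+1 -> g u = 1%N /\ g v = 0%N.
  move=> uv vu; split.
    by have [_ _ h _] := sP (B u); apply: (h u v); rewrite ?BE.
  by have [_ _ _ h] := sP (B v); apply: (h v u); rewrite ?BE // e_sym.
have g_up_inv u v : p v = (p u).+1 -> g u = 1%N -> g v = 0%N -> e u v.
  move=> vu gu gv; have uN : (p u < N)%N by rewrite -vu.
  have [u' [v' [ur vr uv]]] := linked uN.
  have [gu' gv'] := g_up u' v' uv (etrans vr (congr1 S (esym ur))).
  have -> : u = u' by apply: g_inj; [rewrite ur | rewrite gu gu'].
  by have -> : v = v' by apply: g_inj; [rewrite vr | rewrite gv gv'].
have f_inj : injective f.
  move=> u v /eqP; rewrite block_vertex_eq // => /andP[/eqP puv /eqP guv].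
  exact: g_inj.
exists f; split=> [|u v]; first exact: injF_bij.
rewrite clique_path_blockE //.
have [puv|puv] := eqVneq (p u) (p v).
  rewrite puv (_ : (p v == (p v).+1) = false) ?orbF /=; last by lia.
  have [->|uv] := eqVneq u v; first by rewrite eqxx e_irr.
  by rewrite p_clique //; apply/eqP=> /(g_inj _ _ puv)/eqP; apply/negP.
rewrite /=; apply/orP/idP => [[/and3P[/eqP pE /eqP gu /eqP gv]|/and3P[/eqP pE /eqP gv /eqP gu]]|uv].
- exact: g_up_inv.
- by rewrite e_sym; apply: g_up_inv.
- have [vu|vu] := adjacent_blocks uv puv; [left|right].
    by have [-> ->] := g_up u v uv vu; rewrite vu !eqxx.
  by have [-> ->] := g_up v u (etrans (e_sym v u) uv) vu; rewrite vu !eqxx.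
Qed.
End CliquePathRecognition.

(** The actual place on the path of index [j] in the listing from the centre outwards; [zigzag]
    reads only the first half, relying on symmetry. *)
Definition zigzag_pos (N j : nat) : nat :=
  if odd (N - j) then (N - (N - j)./2)%N else (N - j)./2.

Lemma zigzag_pos_le N j : (zigzag_pos N j <= N)%N.
Proof. by rewrite /zigzag_pos; case: ifP => _; lia. Qed.

Lemma zigzag_pos_inj N i j : (i <= N)%N -> (j <= N)%N ->
  (zigzag_pos N i == zigzag_pos N j) = (i == j).
Proof.
by move=> iN jN; rewrite /zigzag_pos; case: ifP => oi; case: ifP => oj; lia.
Qed.

Lemma zigzag_pos_surj N r : (r <= N)%N -> exists2 j, (j <= N)%N & zigzag_pos N j = r.
Proof.
rewrite /zigzag_pos => rN; have [rN2|rN2] := leqP r.*2 N.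
  by exists (N - r.*2)%N; [lia | case: ifP; lia].
by exists (r.*2 - N - 1)%N; [lia | case: ifP; lia].
Qed.

Lemma zigzag_pos_step N i : (0 < i <= N)%N ->
  zigzag_pos N i = (zigzag_pos N i.-2).+1 \/ zigzag_pos N i.-2 = (zigzag_pos N i).+1.
Proof.
by move=> iN; rewrite /zigzag_pos; case: ifP => o1; case: ifP => o2; lia.
Qed.

Lemma zigzag_pos_onto N r : (r < N)%N -> exists i, (0 < i <= N)%N /\
  ((zigzag_pos N i = r /\ zigzag_pos N i.-2 = r.+1) \/
   (zigzag_pos N i = r.+1 /\ zigzag_pos N i.-2 = r)).
Proof.
rewrite /zigzag_pos => rN; have [rN2|rN2] := ltnP r.*2 N.
  by exists (N - r.*2)%N; split; [lia | left; case: ifP; case: ifP; lia].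
by exists (r.*2 - N + 1)%N; split; [lia | right; case: ifP; case: ifP; lia].
Qed.

(** * Graphs whose spectral radius is at most that of the clique path *)

Section Main.
Variables (R : realFieldType) (N k : nat).
Hypothesis k_large : (17 * N.+1 + 15 < 8 * k)%N.
Variables (l1 : R) (e : rel 'I_(k * N.+1)) (l2 : R).
Hypothesis l1_max : rayleigh_max (clique_path k N.+1) l1.
Hypotheses (e_sym : symmetric e) (e_irr : irreflexive e) (e_conn : connected_graph e).
Hypothesis e_indep : indep_num e = N.+1.
Hypothesis l2_max : rayleigh_max e l2.

Let k_gt1 : (1 < k)%N. Proof. by lia. Qed.
Let t := l1 + 1.

Let weights := clique_path_weights k_gt1 l1_max.

Lemma clique_path_radius_ge : k%:R <= t.
Proof.
have h0 : (0 <= N)%N := leq0n N.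
pose C := [set block_vertex h0 (ltn_ord r) | r : 'I_k].
have cardC : #|C| = k.
  rewrite card_imset ?card_ord // => r r' /eqP.
  by rewrite block_vertex_eq eqxx => /eqP/val_inj.
have := @rayleigh_max_clique _ _ _ _ C l1_max (@clique_path_irr k N.+1).
rewrite [X in (0 < X)%N]cardC [X in X%:R]cardC; apply; first exact: ltnW.
move=> _ _ /imsetP[r _ ->] /imsetP[r' _ ->].
by rewrite block_vertex_eq eqxx clique_path_blockE eqxx => ->.
Qed.

Let t_gt1 : 1 < t.
Proof. by apply: lt_le_trans clique_path_radius_ge; rewrite ltr1n. Qed.

(** This is [K <= 2 * t + 2] divided by [t + 1]. *)
Lemma clique_path_radius_le : (t - 1) * (t - k%:R) <= 2.
Proof.
have [s [sE s_ge0 s_neq0 _]] := weights.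
have t0 : 0 < t by apply: lt_trans t_gt1.
have := path_eigen_le sE t0 s_ge0 s_neq0.
have -> : (t ^+ 2 - 1) * (t - k%:R) = (t + 1) * ((t - 1) * (t - k%:R)) by ring.
have -> : 2 * t + 2 = (t + 1) * 2 by ring.
by rewrite ler_pM2l // addr_gt0.
Qed.

Hypothesis l2_le : l2 <= l1.

Lemma minimal_clique_partition : exists b : 'I_(k * N.+1) -> nat,
  [/\ forall u, (b u < N.+1)%N, forall u v, b u = b v -> u != v -> e u v
    & forall i, (i < N.+1)%N -> #|[set u | b u == i]| = k].
Proof.
have tk := clique_path_radius_ge; have tk2 := clique_path_radius_le.
have k5 : (5%:R : R) <= k%:R by rewrite ler_nat; lia.
have kt : (k%:R - 1) * (t - k%:R) <= 2.
  by apply: le_trans tk2; rewrite ler_wpM2r ?subr_ge0 // lerB.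
apply: (clique_partition e_sym e_irr k_large).
- by rewrite card_ord.
- move=> I st; have : (#|I| <= indep_num e)%N.
    apply: (leq_bigmax_cond (F := fun S : {set _} => #|S|)).
    by apply/forall_inP=> u uI; apply/forall_inP=> v vI; apply: st.
  by rewrite [X in (_ <= X)%N]e_indep.
- move=> C cl; case: (posnP #|C|) => [->//|C0].
  have := rayleigh_max_clique l2_max e_irr C0 cl.
  move=> Cl; rewrite -ltnS -(ltr_nat R) (le_lt_trans Cl) // -natr1 ltNge; apply/negP=> l2k.
  (* A clique of size [k + 1] would give [t >= k + 1], hence [k - 1 <= 2], against [k >= 5]. *)
  have t1 : 1 <= t - k%:R by have := l2_le; rewrite /t; lra.
  have : (k%:R - 1) * 1 <= (k%:R - 1) * (t - k%:R) by rewrite ler_wpM2l //; lra.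
  by lra.
have := rayleigh_max_degree l2_max; set E := (\sum_u _)%N => El.
have kN0 : (0 : R) <= (k * N.+1)%N%:R by [].
rewrite -(ler_nat R) !natrM natrD natrX natrB ?(ltnW k_gt1) // -natrM.
(* Uses [(k - 1) * (t - 1) = (k - 1) ^ 2 + (k - 1) * (t - k)], whose last term is at most 2. *)
apply: (@le_trans _ _ ((k%:R - 1) * ((t - 1) * (k * N.+1)%:R))).
  rewrite ler_wpM2l //; first by lra.
  by apply: le_trans El _; rewrite ler_wpM2r // /t addrK.
by rewrite mulrA ler_wpM2r //; lra.
Qed.

Lemma minimal_is_clique_path : l1 <= l2 /\ graph_iso e (clique_path k N.+1).
Proof.
have [b [b_lt b_clique b_card]] := minimal_clique_partition.
have b_onto i : (i < N.+1)%N -> exists u, b u = i.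
  move=> iN; have /set0Pn[u] : [set u | b u == i] != set0.
    by rewrite -card_gt0 b_card // ltnW.
  by rewrite inE => /eqP ui; exists u.
have [c [c_lt cb c_parent]] := block_order e_sym e_conn b_lt b_onto.
have c_clique u v : c u = c v -> u != v -> e u v.
  by move=> /eqP; rewrite cb => /eqP; apply: b_clique.
have c_onto i : (i < N.+1)%N -> exists u, c u = i.
  (* Block 0 has no parent; it is found as the parent of block 1, or is the only block. *)
  case: i => [|i] iN; last by have [u [v [<- _ _]]] := c_parent i.+1 iN; exists u.
  have [N0|N1] := posnP N.
    by exists (block_vertex (leq0n N) k_gt1); have := c_lt (block_vertex (leq0n N) k_gt1); lia.
  by have [u [v [_ _ v0]]] := c_parent 1%N N1; exists v; lia.
have c_card i : (i < N.+1)%N -> #|[set u | c u == i]| = k.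
  move=> iN; have [u ui] := c_onto i iN; rewrite -[RHS](b_card (b u)) //.
  by congr #|pred_of_set _|; apply/setP=> v; rewrite !inE -ui cb.
have [s [sE s_ge0 s_neq0 s_sym]] := weights.
have t0 : 0 < t by apply: lt_trans t_gt1.
pose z := zigzag N s.
have z_gt0 := zigzag_gt0 sE t0 s_ge0 s_neq0 s_sym.
have z_decr := zigzag_decr sE t0 s_ge0 s_neq0 s_sym.
have z_quad := zigzag_quad sE t0 s_sym.
have z_eigen := zigzag_eigen sE t0 s_sym.
have k_gt0 := ltnW k_gt1.
have l2t : l2 <= t - 1 by rewrite /t addrK.
split.
  have := comparison e_sym e_irr c_lt c_clique c_card k_gt0 c_parent t_gt1 z_gt0 z_decr z_quad l2_max.
  by rewrite /t addrK.
have matching := tight_matching e_sym e_irr c_lt c_clique c_card k_gt0 c_parent t_gt1 z_gt0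
  z_decr z_quad l2_max l2t.
have down_unique := tight_down_unique e_sym e_irr c_lt c_clique c_card k_gt0 c_parent t_gt1 z_gt0
  z_decr z_quad l2_max l2t.
have parent := tight_parent e_sym e_irr c_lt c_clique c_card k_gt0 c_parent t_gt1 z_gt0
  z_decr z_quad l2_max l2t z_eigen.
have pE u v : (zigzag_pos N (c u) == zigzag_pos N (c v)) = (c u == c v).
  by rewrite (@zigzag_pos_inj N (c u) (c v) (c_lt u) (c_lt v)).
(* The unique downward edge of a block must be the one found by [tight_parent]. *)
have down u v : e u v -> (c v < c u)%N -> c v = (c u).-2 /\ (0 < c u <= N)%N.
  move=> uv vu; have uN := c_lt u; have cu : (0 < c u < N.+1)%N by lia.
  have [u' [v' [uu' uv' v'E]]] := parent (c u) cu; split=> //.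
  by have [_ ->] := down_unique u v u' v' uv vu uv' ltac:(lia) (esym uu').
apply: (@clique_path_recognition k N e (fun u => zigzag_pos N (c u))) => //.
- by move=> u; apply: zigzag_pos_le.
- by move=> u v /eqP; rewrite pE => /eqP; apply: c_clique.
- move=> r /zigzag_pos_surj[j jN <-]; rewrite -[RHS](c_card j jN).
  by congr #|pred_of_set _|; apply/setP=> u; rewrite !inE; exact: (@zigzag_pos_inj N (c u) j (c_lt u) jN).
- move=> u v w uv; rewrite !pE => cuv uw cuw.
  by apply: (matching u); apply/andP.
- move=> u v uv; rewrite pE neq_ltn => /orP[cuv|cvu].
    have [-> cv] := down v u (etrans (e_sym v u) uv) cuv.
    by have [] := zigzag_pos_step cv; [left|right].
  have [-> cu] := down u v uv cvu.
  by have [] := zigzag_pos_step cu; [right|left].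
- move=> r /zigzag_pos_onto[i [iN iE]].
  have [u [v [ui uv vi]]] := parent i iN.
  case: iE => -[<- <-]; first by exists u, v; rewrite ui vi.
  by exists v, u; rewrite ui vi e_sym.
move=> u v u' v' uv vu uv' vu' uu'.
have cuu : c u = c u' by apply/eqP; rewrite -pE uu'.
have cvv : c v = c v' by apply/eqP; rewrite -pE vu vu' uu'.
(* A link between consecutive places of the path may go up or down in the numbering [c]. *)
case: (ltngtP (c v) (c u)) => [lt|lt|E].
- have lt' : (c v' < c u')%N by rewrite -cuu -cvv.
  exact: down_unique uv lt uv' lt' cuu.
- have lt' : (c u' < c v')%N by rewrite -cuu -cvv.
  rewrite e_sym in uv; rewrite e_sym in uv'.
  by have [-> ->] := down_unique v u v' u' uv lt uv' lt' cvv.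
- by move: vu; rewrite E; lia.
Qed.
End Main.

Theorem theorem1p2 (alpha k : nat) :
  (1 <= alpha)%N -> (17 * alpha + 15 < 8 * k)%N ->
  forall e : rel 'I_(k * alpha),
    simple_graph e -> connected_graph e -> indep_num e = alpha ->
    lambda (clique_path k alpha) <= lambda e /\
    (lambda e = lambda (clique_path k alpha) <-> graph_iso e (clique_path k alpha)).
Proof.
case: alpha => // N _ k_large e [e_sym e_irr] e_conn e_indep.
have n_gt0 : (0 < k * N.+1)%N by lia.
have [l1 l1E l1_max] := lambda_rayleigh_max n_gt0 (@clique_path_sym k N.+1).
have [l2 l2E l2_max] := lambda_rayleigh_max n_gt0 e_sym.
have min_iso := minimal_is_clique_path k_large l1_max e_sym e_irr e_conn e_indep l2_max.
rewrite -l1E -l2E; split.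
  by have [/min_iso[]|/ltW] := leP l2 l1.
split=> [/val_inj l12|iso]; first by apply: (min_iso _).2; rewrite l12.
by rewrite (rayleigh_max_iso iso l2_max l1_max).
Qed.
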